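(* Let $A=[A_1,\ldots,A_n]$ and $B=[B_1,\ldots,B_n]$ be in $[B(\mathcal H)^n]_1^-$ such that $A\overset{H}{\sim}B$. Then the metric $\delta$ satisfies the relation $$\delta(A,B)=\ln\max\left\{\|L_{A,B}\|,\ \|L_{A,B}^{-1}\|\right\}.$$
   Context: $n$ is a positive integer, $\mathcal H$ is a complex Hilbert space, and $B(\mathcal H)$ is the algebra of bounded linear operators on $\mathcal H$. $[B(\mathcal H)^n]_1^-$ (resp. $[B(\mathcal H)^n]_1$) is the set of $(X_1,\ldots,X_n)\in B(\mathcal H)^n$ with $\|X_1X_1^*+\cdots+X_nX_n^*\|^{1/2}\le 1$ (resp. $<1$). Harnack domination: for $A,B\in[B(\mathcal H)^n]_1^-$ and $c>0$, $A\overset{H}{\prec}_c B$ means that $\mathrm{Re}\,p(A)\le c^2\,\mathrm{Re}\,p(B)$ for every $m\in\mathbb N$ and every noncommutative polynomial with matrix coefficients $p\in\mathbb C[X_1,\ldots,X_n]\otimes M_m$ such that $\mathrm{Re}\,p(X)\ge0$ for all $X\in[B(\mathcal K)^n]_1$, where $\mathcal K$ is an infinite-dimensional Hilbert space ($\mathrm{Re}\,T=\frac12(T+T^* )$). $A\overset{H}{\prec}B$ means $A\overset{H}{\prec}_cB$ for some $c>0$. $A\overset{H}{\sim}_cB$ means $A\overset{H}{\prec}_cB$ and $B\overset{H}{\prec}_cA$; $A\overset{H}{\sim}B$ (Harnack equivalence) means $A\overset{H}{\sim}_cB$ for some $c\ge1$. For $A\overset{H}{\sim}B$, the hyperbolic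 metric is $\delta(A,B):=\ln\inf\{c\ge1:\ A\overset{H}{\sim}_cB\}$. $\mathbb F_n^+$ is the unital free semigroup on generators $g_1,\ldots,g_n$ with identity $g_0$; $V_\alpha:=V_{i_1}\cdots V_{i_k}$ if $\alpha=g_{i_1}\cdots g_{i_k}$, $V_{g_0}:=I$. A minimal isometric dilation of $T\in[B(\mathcal H)^n]_1^-$ is an $n$-tuple $V$ of isometries on $\mathcal K_T\supseteq\mathcal H$ with $\sum_iV_iV_i^*\le I$, $V_i^*|_{\mathcal H}=T_i^*$ and $\mathcal K_T=\bigvee_{\alpha\in\mathbb F_n^+}V_\alpha\mathcal H$; it is unique up to an isomorphism. If $V$ on $\mathcal K_A$ and $W$ on $\mathcal K_B$ are the minimal isometric dilations of $A$ and $B$ and $A\overset{H}{\prec}B$, then $L_{B,A}:\mathcal K_B\to\mathcal K_A$ denotes the (unique) bounded operator with $L_{B,A}|_{\mathcal H}=I_{\mathcal H}$ (i.e. $L_{B,A}h=h$ for $h\in\mathcal H$) and $L_{B,A}W_i=V_iL_{B,A}$, $i=1,\ldots,n$; that is, $L_{B,A}\bigl(\sum_{|\alpha|\le q}W_\alpha h_\alpha\bigr)=\sum_{|\alpha|\le q}V_\alpha h_\alpha$. $L_{A,B}:\mathcal K_A\to\mathcal K_B$ is obtained by exchanging the roles of $A$ and $B$. *)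

(* Defs.v *)
From HB Require Import structures.
From mathcomp Require Import all_boot all_order all_algebra.
From mathcomp Require Import finmap complex.
From mathcomp Require Import boolp classical_sets functions reals topology.
From mathcomp Require Import normedtype exp.
From mathcomp Require Import ring.

Set Implicit Arguments.
Unset Strict Implicit.
Unset Printing Implicit Defensive.

Import Order.TTheory GRing.Theory Num.Theory.
Import numFieldNormedType.Exports.

Local Open Scope classical_set_scope.
Local Open Scope ring_scope.

(* The inner product is linear in its first argument and conjugate-linear in
   the second.  Norms of elements of R[i]-normed modules are R[i]-valued. *)
HB.mixin Record CompleteNormedModule_isHilbert (R : realType) H
    of CompleteNormedModule R[i] H := {
  hdot : {dot H for Num.conj};
  hdotxx : forall x : H, hdot x x = `|x| ^+ 2
}.

#[short(type="hilbertType")]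
HB.structure Definition Hilbert (R : realType) :=
  {H of CompleteNormedModule_isHilbert R H & CompleteNormedModule R[i] H}.

HB.structure Definition BoundedOperator (R : realType) (U V : hilbertType R) :=
  {f of @GRing.Linear R[i] U V *:%R f & @isContinuous U V f}.

Notation "{ 'bounded' U -> V }" := (@BoundedOperator.type _ U V)
  (at level 0, U at level 98, V at level 99,
   format "{ 'bounded'  U  ->  V }") : type_scope.

Section dot_norm.
Context {C : numClosedFieldType} {U : lmodType C} (f : {dot U for @Num.conj C}).

Lemma dot_CauchySchwarz u v : `|f u v| ^+ 2 <= f u u * f v v.
Proof.
have [->|v0] := eqVneq v 0.
  by rewrite !linear0r normr0 expr0n mulr0.
have fv : 0 < f v v by rewrite dnorm_gt0.
have := dnorm_ge0 f (f v v *: u - f u v *: v).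
rewrite dnormB !dnormZ !linearZl_LR !linearZr_LR /=.
have fvr : (f v v)^* = f v v by rewrite geC0_conj // ltW.
have -> : `|f v v| = f v v by rewrite gtr0_norm.
have fc : (f u v) * (f u v)^* = `|f u v| ^+ 2 by rewrite normCK.
set a := `|f u v| ^+ 2 in fc *.
have -> : f v v ^+ 2 * f u u + a * f v v
   - (f v v * ((f u v)^* * f u v) + (f v v * ((f u v)^* * f u v))^*)
   = f v v * (f u u * f v v - a).
  rewrite !rmorphM /= fvr !conjCK -fc; ring.
by rewrite pmulr_rge0 // subr_ge0.
Qed.

Lemma dot_ler_normD u v :
  sqrtC (f (u + v) (u + v)) <= sqrtC (f u u) + sqrtC (f v v).
Proof.
rewrite -(@ler_pXn2r _ 2) ?nnegrE ?addr_ge0 ?sqrtC_ge0 ?dnorm_ge0 //.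
rewrite sqrrD !sqrtCK dnormD /= [X in _ <= X]addrAC lerD2l.
rewrite -[_ *+ 2]mulr_natr.
have -> : f u v + (f u v)^* = 'Re (f u v) * 2.
  by rewrite ReE divfK ?pnatr_eq0.
rewrite ler_pM2r ?ltr0n // (le_trans (leif_Re_Creal _).1) //.
rewrite -(@ler_pXn2r _ 2) ?nnegrE ?mulr_ge0 ?sqrtC_ge0 ?dnorm_ge0 //.
by rewrite exprMn !sqrtCK dot_CauchySchwarz.
Qed.

End dot_norm.

(* The Hilbert space H^m, on which M_m (x) B(H) acts.  It is a separate
   constant so that it carries the l^2 norm. *)
Definition hpow (R : realType) (H : hilbertType R) (m : nat) :=
  {ffun 'I_m -> H}.

Section hpow.
Context {R : realType} {H : hilbertType R} {m : nat}.
Implicit Types x y : hpow H m.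

HB.instance Definition _ := GRing.Lmodule.on (hpow H m).

Definition hpow_dot x y : R[i] := \sum_(i < m) hdot (x i) (y i).

Let hpow_dot_linearl y : linear_for *%R (hpow_dot ^~ y).
Proof.
move=> a u v; rewrite /hpow_dot mulr_sumr -big_split; apply: eq_bigr => i _.
by rewrite !ffunE linearDl linearZl_LR.
Qed.

Let hpow_dot_linearr x : linear_for (Num.conj \; *%R) (hpow_dot x).
Proof.
move=> a u v; rewrite /hpow_dot /= mulr_sumr -big_split; apply: eq_bigr => i _.
by rewrite !ffunE linearDr linearZr_LR.
Qed.

HB.instance Definition _ := @bilinear_isBilinear.Build R[i] _ _ _ _ _ hpow_dot
  (conj hpow_dot_linearl hpow_dot_linearr).

Let hpow_dot_herm x y : hpow_dot x y = (-1) ^+ false * (hpow_dot y x)^*.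
Proof.
rewrite expr0 mul1r /hpow_dot rmorph_sum; apply: eq_bigr => i _.
by rewrite [LHS]hermC expr0 mul1r.
Qed.

HB.instance Definition _ :=
  @isHermitianSesquilinear.Build _ _ _ _ hpow_dot hpow_dot_herm.

Let hpow_dot_gt0 x : x != 0 -> 0 < hpow_dot x x.
Proof.
move=> x0; rewrite lt_def /hpow_dot sumr_ge0 ?andbT; last first.
  by move=> i _; rewrite dnorm_ge0.
apply: contra x0; rewrite psumr_eq0; last by move=> i _; rewrite dnorm_ge0.
move=> /allP x0; apply/eqP/ffunP => i; rewrite ffunE; apply/eqP.
by rewrite -(dnorm_eq0 hdot); apply: x0; rewrite mem_index_enum.
Qed.

HB.instance Definition _ := @isDotProduct.Build _ _ hpow_dot hpow_dot_gt0.

Let hpow_norm x : R[i] := sqrtC (hpow_dot x x).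

Let hpow_norm_triangle x y : hpow_norm (x + y) <= hpow_norm x + hpow_norm y.
Proof. exact: dot_ler_normD. Qed.

Let hpow_normZ (a : R[i]) x : hpow_norm (a *: x) = `|a| * hpow_norm x.
Proof.
rewrite /hpow_norm dnormZ sqrtCM ?nnegrE ?exprn_ge0 ?dnorm_ge0 //.
by rewrite sqrCK.
Qed.

Let hpow_norm0_eq0 x : hpow_norm x = 0 -> x = 0.
Proof. by move=> /eqP; rewrite sqrtC_eq0 dnorm_eq0 => /eqP. Qed.

HB.instance Definition _ := Lmodule_isNormed.Build R[i] (hpow H m)
  hpow_norm_triangle hpow_normZ hpow_norm0_eq0.

Lemma hpow_normE x : `|x| ^+ 2 = \sum_(i < m) `|x i| ^+ 2.
Proof.
rewrite [ `|x| ]/(hpow_norm x) sqrtCK; apply: eq_bigr => i _.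
by rewrite hdotxx.
Qed.

Let hpow_norm_coord x i : `|x i| <= `|x|.
Proof.
rewrite -(@ler_pXn2r _ 2) ?nnegrE ?normr_ge0 // hpow_normE (bigD1 i) //=.
by rewrite lerDl sumr_ge0 // => j _; rewrite exprn_ge0.
Qed.

Let hpow_complete (F : set_system (hpow H m)) :
  ProperFilter F -> cauchy F -> cvg F.
Proof.
move=> FF Fc.
have cvg_coord i : cvg ((fun x : hpow H m => x i) @ F).
  apply: cauchy_cvg; apply/cauchy_ballP => e e0.
  move/cauchy_ballP : Fc => /(_ _ e0) Fe.
  move: Fe => -[[P Q] [FP FQ] PQ].
  exists ((fun x : hpow H m => x i) @` P, (fun x : hpow H m => x i) @` Q).
    split; rewrite /= nbhs_filterE /=.
      by apply: (@filterS _ F _ P) => // x Px; exists x.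
    by apply: (@filterS _ F _ Q) => // x Qx; exists x.
  move=> [_ _] /= [[x Px <-] [y Qy <-]].
  have := PQ (x, y) (conj Px Qy); rewrite -!ball_normE /= => /le_lt_trans; apply.
  have -> : x i - y i = (x - y) i by rewrite !ffunE.
  exact: hpow_norm_coord.
have {cvg_coord} [l cvgl] : exists l : hpow H m,
    forall i, (fun x : hpow H m => x i) @ F --> l i.
  exists [ffun i => lim ((fun x : hpow H m => x i) @ F)] => i.
  by rewrite ffunE; apply: cvg_coord.
apply/cvg_ex; exists l; apply/cvgrPdist_le => e e0.
have d0 : 0 < e / m.+1%:R by rewrite divr_gt0 ?ltr0n.
have : F [set x : hpow H m | forall i, `|l i - x i| <= e / m.+1%:R].
  by apply: filter_forall => i; move/cvgrPdist_le : (cvgl i) => /(_ _ d0).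
apply: filterS => x lx.
rewrite -(@ler_pXn2r _ 2) ?nnegrE ?normr_ge0 ?(ltW e0) // hpow_normE.
apply: (@le_trans _ _ (\sum_(i < m) (e / m.+1%:R) ^+ 2)).
  apply: ler_sum => i _.
  by rewrite !ffunE ler_pXn2r ?nnegrE ?normr_ge0 ?(ltW d0) ?lx.
rewrite sumr_const card_ord expr_div_n -[_ *+ m]mulr_natr -mulrA ger_pMr ?exprn_gt0 //.
rewrite mulrC ler_pdivrMr ?exprn_gt0 ?ltr0n // mul1r -natrX ler_nat.
by rewrite (leq_trans (leqnSn m)) // leq_pmulr.
Qed.

HB.instance Definition _ := Uniform_isComplete.Build (hpow H m) hpow_complete.

Let hpow_dotxx x : hpow_dot x x = `|x| ^+ 2.
Proof. by rewrite [ `|x| ]/(hpow_norm x) sqrtCK. Qed.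

HB.instance Definition _ :=
  CompleteNormedModule_isHilbert.Build R (hpow H m) hpow_dotxx.

Lemma hpow_hdotE x y : hdot x y = \sum_(i < m) hdot (x i) (y i).
Proof. by []. Qed.

End hpow.

Section operators.
Context {R : realType}.

(* [adj f y] is the vector z representing the functional x |-> <f x, y>; by the
   Riesz theorem it exists, and is unique, when f is a bounded operator. *)
Definition adj {U V : hilbertType R} (f : U -> V) : V -> U :=
  fun y => get [set z | forall x, hdot (f x) y = hdot x z].

Definition opnorm {U V : hilbertType R} (f : U -> V) : R :=
  sup [set complex.Re `|f x| | x in [set x : U | `|x| <= 1]].

Definition re_op {U : hilbertType R} (f : U -> U) : U -> U :=
  fun x => 2^-1 *: (f x + adj f x).

(* Loewner order on self-adjoint operators; [<=] on R[i] compares complex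
   numbers with the same imaginary part. *)
Definition op_le {U : hilbertType R} (f g : U -> U) : Prop :=
  forall x, hdot (f x) x <= hdot (g x) x.

Definition infinite_dimensional (U : hilbertType R) : Prop :=
  ~ exists (d : nat) (v : 'I_d -> U),
      forall x, exists c : 'I_d -> R[i], x = \sum_(i < d) c i *: v i.

End operators.

Section tuples.
Context {R : realType} {n : nat}.

Definition row_gram {U : hilbertType R} (X : 'I_n -> {bounded U -> U}) :
  U -> U := fun x => \sum_(i < n) X i (adj (X i) x).

Definition row_norm {U : hilbertType R} (X : 'I_n -> {bounded U -> U}) : R :=
  Num.sqrt (opnorm (row_gram X)).

(* Elements of the free semigroup on n generators are words over 'I_n, the
   empty word being the identity g_0. *)
Definition word_op {U : hilbertType R} (X : 'I_n -> {bounded U -> U})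
    (w : seq 'I_n) : U -> U :=
  foldr (fun i f => X i \o f) idfun w.

(* C[X_1, ..., X_n] (x) M_m: finitely supported families of m x m matrices
   indexed by words. *)
Definition ncpoly (m : nat) := {fsfun seq 'I_n -> 'M[R[i]]_m with 0}.

Definition ncpoly_op {m} {U : hilbertType R} (p : ncpoly m)
    (X : 'I_n -> {bounded U -> U}) : hpow U m -> hpow U m :=
  fun h => [ffun i : 'I_m =>
    \sum_(w <- finsupp p) \sum_(j < m) p w i j *: word_op X w (h j)].

Definition re_nonneg_on_ball (K : hilbertType R) {m} (p : ncpoly m) : Prop :=
  forall X : 'I_n -> {bounded K -> K}, row_norm X < 1 ->
    op_le (fun=> 0) (re_op (ncpoly_op p X)).

Context (K : hilbertType R) {H : hilbertType R}.
Implicit Types A B : 'I_n -> {bounded H -> H}.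

Definition harnack_dom (c : R) A B : Prop :=
  forall (m : nat) (p : ncpoly m), re_nonneg_on_ball K p ->
    op_le (re_op (ncpoly_op p A))
          (fun h => (c ^+ 2)%:C%C *: re_op (ncpoly_op p B) h).

Definition harnack_equiv_by (c : R) A B : Prop :=
  harnack_dom c A B /\ harnack_dom c B A.

Definition harnack_equiv A B : Prop :=
  exists c : R, 1 <= c /\ harnack_equiv_by c A B.

Definition hyperbolic_metric A B : R :=
  ln (inf [set c : R | 1 <= c /\ harnack_equiv_by c A B]).

End tuples.

(* The inclusion of H in the dilation space is an isometric embedding iota.
   As each V_w iota(H) is a linear subspace, the linear span of their union
   consists of the finite sums of elements V_w (iota h). *)
Record minimal_isometric_dilation (R : realType) (n : nat)
    (H K : hilbertType R) (T : 'I_n -> {bounded H -> H})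
    (iota : {bounded H -> K}) (V : 'I_n -> {bounded K -> K}) : Prop := {
  mid_embed : forall h, `|iota h| = `|h|;
  mid_isometry : forall i x, `|V i x| = `|x|;
  mid_row : op_le (row_gram V) idfun;
  mid_dilation : forall i h, adj (V i) (iota h) = iota (adj (T i) h);
  mid_minimal :
    closure [set x | exists s : seq (seq 'I_n * H),
                       x = \sum_(a <- s) word_op V a.1 (iota a.2)] = setT
}.

(* For the dilations (iotaA, V) of A and (iotaB, W) of B, the properties that
   characterise L_{A,B} : K_A -> K_B. *)
Definition dilation_intertwiner (R : realType) (n : nat)
    (H KA KB : hilbertType R)
    (iotaA : {bounded H -> KA}) (V : 'I_n -> {bounded KA -> KA})
    (iotaB : {bounded H -> KB}) (W : 'I_n -> {bounded KB -> KB})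
    (L : {bounded KA -> KB}) : Prop :=
  (forall h, L (iotaA h) = iotaB h) /\ (forall i x, L (V i x) = W i (L x)).

(* Main.v *)
Require Import Defs.
From HB Require Import structures.
From mathcomp Require Import all_boot all_order all_algebra.
From mathcomp Require Import finmap complex.
From mathcomp Require Import boolp classical_sets functions reals topology.
From mathcomp Require Import normedtype exp derive.
From mathcomp Require Import ring.

Set Implicit Arguments.
Unset Strict Implicit.
Unset Printing Implicit Defensive.

Import Order.TTheory GRing.Theory Num.Theory.
Import numFieldNormedType.Exports.

Local Open Scope classical_set_scope.
Local Open Scope ring_scope.

(* Up to replacing c by an arbitrary c' > c, A is Harnack dominated by B with
   constant c exactly when |sum V_w h_w| <= c |sum W_w h_w| for all finite
   families (h_w), i.e. when the intertwiner K_B -> K_A has norm at most c.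

   If the domination holds, apply it to the polynomial whose real part is half
   the multi-Toeplitz kernel of the given words; that this polynomial has
   nonnegative real part on the ball follows by induction on the word length.

   Conversely, let L : K_B -> K_A be an intertwiner of norm at most c < c'.  The
   form q(x, y) = c'^2 <x, y> - <L x, L y> is an inner product for which W is
   still a row isometry.  Gram-Schmidt compresses rW, r < 1, to a strict row
   contraction on K which is faithful on any given finite set of vectors, so
   Re p >= 0 on the ball of B(K)^n gives Re q(p(W) h, h) >= 0 for h in H, and
   q(p(W) h, h) = c'^2 <p(B) h, h> - <p(A) h, h>. *)

(** * Completeness and infima over complex scalars *)

(** The sets [P e] generate a Cauchy filter. This form of completeness serves both the minimisation
    in [riesz] and the extension by density in [graph_extension]. *)
Lemma nested_limit (C : numFieldType) (H : completeNormedModType C)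
    (P : C -> set H) :
  (forall e, 0 < e -> P e !=set0) ->
  (forall d e, 0 < d -> d <= e -> P d `<=` P e) ->
  (forall e, 0 < e ->
     exists2 d, 0 < d & forall x y, P d x -> P d y -> `|x - y| < e) ->
  exists z, forall e, 0 < e -> exists2 x, P e x & `|z - x| < e.
Proof.
move=> P0 Pmono Pdiam.
pose F : set_system H := [set A | exists2 d, 0 < d & P d `<=` A].
have FF : ProperFilter F.
  apply: Build_ProperFilter_ex.
    by move=> A [d d0 PA]; have [x /PA Ax] := P0 _ d0; exists x.
  split=> [|A B [d d0 PA] [e e0 PB]|A B AB [d d0 PA]].
  - by exists 1 => //; exact: ltr01.
  - have [de|/ltW de] := real_leP (gtr0_real d0) (gtr0_real e0).
      by exists d => // x Px; split; [exact: PA|apply: PB; apply: (Pmono d)].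
    by exists e => // x Px; split; [apply: PA; apply: (Pmono e)|exact: PB].
  - by exists d => // x /PA /AB.
have /cvg_ex[z Fz] : cvg F.
  apply: cauchy_cvg; apply/cauchy_ballP => e e0.
  have [d d0 dP] := Pdiam _ e0.
  exists (P d, P d); first by split; exists d.
  move=> [x y] [/= Px Py]; rewrite -ball_normE /=; exact: dP.
exists z => e e0.
have /fcvgrPdist_lt/(_ e e0)[d d0 dP] := Fz.
have [de|/ltW de] := real_leP (gtr0_real d0) (gtr0_real e0).
  have [x Px] := P0 _ d0; exists x; [exact: (Pmono d)|exact: dP].
have [x Px] := P0 _ e0; exists x => //.
by apply: dP; exact: (Pmono e).
Qed.

(** A common lower bound in the order of [R[i]] forces all [J x] to share one imaginary part, so the
    infimum is that of the real parts. *)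
Lemma complex_inf (R : realType) (T : Type) (J : T -> R[i]) (x0 : T) (b : R[i]) :
  (forall x, b <= J x) ->
  exists m, (forall x, m <= J x) /\ forall e, 0 < e -> exists x, J x <= m + e.
Proof.
move=> bJ.
pose S := [set complex.Re (J x) | x in setT].
have ImJ x : complex.Im (J x) = complex.Im (J x0).
  by have := bJ x; have := bJ x0; rewrite !lecE => /andP[/eqP -> _] /andP[/eqP -> _].
have hS : has_inf S.
  split; first by exists (complex.Re (J x0)), x0.
  exists (complex.Re b) => _ [x _ <-].
  by have := bJ x; rewrite lecE => /andP[].
exists (Complex (inf S) (complex.Im (J x0))); split=> [x|e e0].
  rewrite lecE /= ImJ eqxx /=; apply: ge_inf; first by case: hS.
  by exists x.
have [er ei] : 0 < complex.Re e /\ complex.Im e = 0.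
  by move: e0; rewrite ltcE /= => /andP[/eqP -> ->].
have [_ [x _ <-] xe] := inf_adherent er hS.
exists x; rewrite lecE raddfD /= ei addr0 ImJ eqxx /= raddfD /=; exact: ltW.
Qed.

Lemma small_eq0 (C : numFieldType) (V : normedZmodType C) (x : V) (k : C) : 0 <= k ->
  (forall e, 0 < e -> `|x| <= k * e) -> x = 0.
Proof.
move=> k0 xe; apply/eqP; rewrite -normr_eq0 eq_le normr_ge0 andbT.
have k1 : 0 < k + 1 by rewrite ltr_wpDl.
have [x0|x0] := eqVneq `|x| 0; first by rewrite x0.
have {}x0 : 0 < `|x| by rewrite lt_def x0 normr_ge0.
have := xe (`|x| / (k + 1)) (divr_gt0 x0 k1).
rewrite mulrA ler_pdivlMr // mulrDr mulr1 mulrC gerDl.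
by [].
Qed.


Section dot.
Context {R : realType} {U : lmodType R[i]} (f : {dot U for @Num.conj R[i]}).

Lemma dotC u v : f u v = (f v u)^*.
Proof. by rewrite hermC expr0 mul1r. Qed.
End dot.

(** * Riesz representation and adjoints *)

Section hdot.
Context {R : realType} {H : hilbertType R}.
Implicit Types (x y z : H) (a : R[i]).

Lemma ipC x y : hdot x y = (hdot y x)^*.
Proof. exact: dotC. Qed.

Lemma ipDl x y z : hdot (x + y) z = hdot x z + hdot y z.
Proof. exact: linearDl. Qed.

Lemma ipDr x y z : hdot x (y + z) = hdot x y + hdot x z.
Proof. exact: linearDr. Qed.

Lemma ipBr x y z : hdot x (y - z) = hdot x y - hdot x z.
Proof. exact: linearBr. Qed.

Lemma ipZl a x y : hdot (a *: x) y = a * hdot x y.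
Proof. exact: linearZl_LR. Qed.

Lemma ipZr a x y : hdot x (a *: y) = a^* * hdot x y.
Proof. exact: linearZr_LR. Qed.

Lemma ip0l x : hdot 0 x = 0 :> R[i].
Proof. exact: linear0l. Qed.

Lemma ip0r x : hdot x 0 = 0 :> R[i].
Proof. exact: linear0r. Qed.

Lemma ip_suml (I : Type) (r : seq I) (P : pred I) (F : I -> H) y :
  hdot (\sum_(i <- r | P i) F i) y = \sum_(i <- r | P i) hdot (F i) y.
Proof. exact: linear_sumlz. Qed.

Lemma ip_sumr (I : Type) (r : seq I) (P : pred I) (F : I -> H) y :
  hdot y (\sum_(i <- r | P i) F i) = \sum_(i <- r | P i) hdot y (F i).
Proof. exact: linear_sumr. Qed.

Lemma ipxx x : hdot x x = `|x| ^+ 2.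
Proof. exact: hdotxx. Qed.

Lemma ipNl x y : hdot (- x) y = - hdot x y.
Proof. exact: linearNl. Qed.

Lemma ipNr x y : hdot x (- y) = - hdot x y.
Proof. exact: linearNr. Qed.

Definition ipE := (ipDl, ipDr, ipNl, ipNr, ipZl, ipZr).

Lemma norm_dot x y : `|hdot x y| <= `|x| * `|y|.
Proof.
rewrite -(@ler_pXn2r _ 2) ?nnegrE ?mulr_ge0 // exprMn -!hdotxx.
exact: dot_CauchySchwarz.
Qed.

Lemma hdot_inj x y : (forall v, hdot v x = hdot v y) -> x = y.
Proof.
move=> xy; apply/eqP; rewrite -subr_eq0 -normr_eq0.
by rewrite -sqrf_eq0 -ipxx ipBr xy subrr.
Qed.

End hdot.

Section riesz.
Context {R : realType} {H : hilbertType R}.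
Local Notation C := R[i].
Implicit Types x y v : H.

(** The representing vector is the minimiser of [|x|^2 - 2 Re (phi x)]; near-minimisers are close to
    each other by the parallelogram identity. *)
Lemma riesz (phi : H -> C) (M : C) : 0 <= M ->
  (forall a x y, phi (a *: x + y) = a * phi x + phi y) ->
  (forall x, `|phi x| <= M * `|x|) ->
  exists z, forall x, phi x = hdot x z.
Proof.
move=> M0 philin phiM.
have phi0 : phi 0 = 0.
  by apply/eqP; rewrite -normr_le0 (le_trans (phiM 0)) // normr0 mulr0.
have phiZ a x : phi (a *: x) = a * phi x.
  by have := philin a x 0; rewrite addr0 phi0 addr0.
have phiD x y : phi (x + y) = phi x + phi y.
  by have := philin 1 x y; rewrite scale1r mul1r.
pose J x : C := hdot x x - (phi x + (phi x)^*).
have [x|m [mJ Jm]] := @complex_inf R H J 0 (- M ^+ 2).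
  have phx : phi x + (phi x)^* <= 2 * (M * `|x|).
    rewrite (le_trans (real_ler_norm _)) //.
      by rewrite CrealE rmorphD /= conjCK addrC.
    rewrite (le_trans (ler_normD _ _)) // norm_conjC.
    by rewrite (_ : 2 = 1 + 1) // mulrDl mul1r lerD.
  rewrite /J ipxx -subr_ge0.
  have -> : `|x| ^+ 2 - (phi x + (phi x)^*) - - M ^+ 2 =
     (`|x| - M) ^+ 2 + (2 * (M * `|x|) - (phi x + (phi x)^*)) by ring.
  rewrite addr_ge0 ?subr_ge0 // real_exprn_even_ge0 // rpredB ?normr_real //.
  exact: ger0_real.
have par x y : `|x - y| ^+ 2 = 2 * J x + 2 * J y - 4 * J (2^-1 *: (x + y)).
  rewrite /J -ipxx phiZ phiD !ipE /=.
  rewrite !(rmorphM, rmorphD) /= fmorphV /= rmorph_nat; by field.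
(* A nearly minimal [x] nearly represents [phi]: moving it along [v] by [- s * w^*] lowers [J] by at
   least [s |w|^2], which cannot exceed [e ^+ 2]. *)
have dist_dot v x e : 0 < e -> J x <= m + e ^+ 2 ->
    `|hdot v x - phi v| <= e * (`|v| + 1).
  move=> e0 Jx; set w := hdot v x - phi v.
  have phivE : phi v = hdot v x - w by rewrite /w; ring.
  clearbody w.
  pose s : C := (`|v| ^+ 2 + 1)^-1.
  have v1 : 0 < `|v| ^+ 2 + 1 by rewrite ltr_wpDl // exprn_ge0.
  have s0 : 0 < s by rewrite invr_gt0.
  have sr : s^* = s by rewrite geC0_conj // ltW.
  have Jxv : J (x + (- s * w^* ) *: v) =
      J x - s * `|w| ^+ 2 * (2 - s * `|v| ^+ 2).
    rewrite /J !ipE phiD phiZ normCK -ipxx (ipC x v).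
    rewrite phivE.
    rewrite !(rmorphM, rmorphB, rmorphD, rmorphN) /=.
    rewrite ?(rmorphM, rmorphB, rmorphN) /= !conjCK sr; ring.
  have sv : s * `|v| ^+ 2 <= 1.
    by rewrite mulrC ler_pdivrMr // mul1r lerDl.
  have : s * `|w| ^+ 2 <= e ^+ 2.
    have h : s * `|w| ^+ 2 * (2 - s * `|v| ^+ 2) <= e ^+ 2.
      have := mJ (x + (- s * w^* ) *: v).
      by rewrite Jxv lerBrDr => /le_trans/(_ Jx); rewrite lerD2l.
    apply: le_trans h; rewrite ler_peMr //.
      by rewrite mulr_ge0 ?exprn_ge0 // ltW.
    by rewrite lerBrDr (_ : 2 = 1 + 1) // lerD2l.
  rewrite mulrC ler_pdivrMr // => wle.
  rewrite -(@ler_pXn2r _ 2) ?nnegrE ?mulr_ge0 ?addr_ge0 // ?(ltW e0) // exprMn.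
  rewrite (le_trans wle) // ler_pM2l ?exprn_gt0 // sqrrD1 lerD2r lerDl.
  by rewrite mulrn_wge0.
have [e e0|d e d0 de u|e e0|z zP] :=
  @nested_limit _ H (fun e => [set x | J x <= m + e ^+ 2]).
- by apply: Jm; rewrite exprn_gt0.
- move=> /le_trans; apply; rewrite lerD2l lerXn2r ?nnegrE //.
    exact: ltW.
  by rewrite ltW // (lt_le_trans d0).
- exists (e / 3) => [|x y Jx Jy]; first by rewrite divr_gt0.
  rewrite -(@ltr_pXn2r _ 2) ?nnegrE // ?(ltW e0) // par.
  apply: (@le_lt_trans _ _ (4 * (e / 3) ^+ 2)).
    rewrite -subr_ge0; set z := 2^-1 *: _.
    have -> : 4 * (e / 3) ^+ 2 - (2 * J x + 2 * J y - 4 * J z) =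
      2 * (m + (e / 3) ^+ 2 - J x) + 2 * (m + (e / 3) ^+ 2 - J y) + 4 * (J z - m).
      by field.
    by rewrite !addr_ge0 // mulr_ge0 // subr_ge0.
  rewrite expr_div_n mulrCA gtr_pMr ?exprn_gt0 // ltr_pdivrMr ?exprn_gt0 //.
  by rewrite mul1r -natrX ltr_nat.
exists z => v; apply/esym/eqP; rewrite -subr_eq0; apply/eqP.
apply: (@small_eq0 _ _ _ (`|v| + (`|v| + 1))) => [|e e0]; first by rewrite !addr_ge0.
have [x Jx zx] := zP _ e0.
have -> : hdot v z - phi v = hdot v (z - x) + (hdot v x - phi v).
  by rewrite ipBr; ring.
rewrite (le_trans (ler_normD _ _)) // mulrDl lerD //; last by rewrite mulrC dist_dot.
by rewrite (le_trans (norm_dot _ _)) // ler_wpM2l // ltW.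
Qed.
End riesz.

Section bounded_operators.
Context {R : realType} {U V : hilbertType R}.
Local Notation C := R[i].

Lemma bounded_opP (f : {bounded U -> V}) :
  exists2 M : C, 0 <= M & forall x, `|f x| <= M * `|x|.
Proof.
have fc : {for 0, continuous f} by apply: cts_fun.
have /linear_boundedP/pinfty_ex_gt0[M M0 fM] := continuous_linear_bounded 0 fc.
by exists M => //; exact: ltW.
Qed.

Lemma bounded_op_pack (f : U -> V) (M : C) : 0 <= M ->
  (forall a x y, f (a *: x + y) = a *: f x + f y) ->
  (forall x, `|f x| <= M * `|x|) ->
  exists L : {bounded U -> V}, L =1 f.
Proof.
move=> M0 flin fM.
pose Flin := GRing.isLinear.Build C U V *:%R f flin.
pose g : {linear U -> V} := HB.pack f Flin.
have gc : continuous g.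
  apply: bounded_linear_continuous; apply/linear_boundedP.
  exists M; split; first exact: ger0_real.
  move=> r Mr x; apply: le_trans (fM x) _.
  by rewrite ler_wpM2r // ltW.
pose Fc := isContinuous.Build U V f gc.
pose h : {bounded U -> V} := HB.pack f Flin Fc.
by exists h.
Qed.


(** A relation rather than the function [adj], so that maps such as [word_op X w] and
    [ncpoly_op p X], not packaged as bounded operators, can be given explicit adjoints. *)
Definition adjoint_pair (f : U -> V) (g : V -> U) :=
  forall x y, hdot (f x) y = hdot x (g y) :> C.

Lemma adj_eq (f : U -> V) (g : V -> U) : adjoint_pair f g -> adj f =1 g.
Proof.
move=> fg y; apply: hdot_inj => x; rewrite -fg; apply/esym.
have := @getPex _ [set z | forall x, hdot (f x) y = hdot x z].
by apply; exists (g y) => v; exact: fg.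
Qed.

Lemma adjP (f : {bounded U -> V}) : adjoint_pair f (adj f).
Proof.
have [M M0 fM] := bounded_opP f.
move=> x y; have [|a u v|u|z zP] := @riesz R U (fun x => hdot (f x) y) (M * `|y|).
- by rewrite mulr_ge0.
- by rewrite linearP ipDl ipZl.
- rewrite (le_trans (norm_dot _ _)) // mulrAC ler_wpM2r //.
have := @getPex _ [set z | forall x, hdot (f x) y = hdot x z].
by apply; exists z.
Qed.

Lemma opnorm_le (f : U -> V) (M : R) : 0 <= M ->
  (forall x, `|f x| <= M%:C%C * `|x|) -> opnorm f <= M.
Proof.
move=> M0 fM; apply: ge_sup.
  by exists (complex.Re `|f 0|), 0 => //=; rewrite normr0.
move=> _ [x /= x1 <-].
have : `|f x| <= M%:C%C.
  by rewrite (le_trans (fM x)) // ler_piMr // ler0c.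
by rewrite lecE => /andP[].
Qed.

(** The bound [M] makes the set defining [opnorm] bounded above, so that its [sup] is a true
    supremum; the rest is normalisation of [x]. *)
Lemma opnorm_ge (f : U -> V) (M : C) : 0 <= M ->
  (forall a x, f (a *: x) = a *: f x) ->
  (forall x, `|f x| <= M * `|x|) ->
  forall x, `|f x| <= (opnorm f)%:C%C * `|x|.
Proof.
move=> M0 fZ fM x.
have [->|x0] := eqVneq x 0.
  by rewrite normr0 mulr0 -[X in f X](scale0r 0) fZ scale0r normr0.
have nx : 0 < `|x| by rewrite normr_gt0.
have xn1 : `| (`|x|^-1 *: x) | = 1 by rewrite normrZ normfV normr_id mulVf // gt_eqF.
have fx : `|f (`|x|^-1 *: x)| = `|x|^-1 * `|f x|.
  by rewrite fZ normrZ normfV normr_id.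
rewrite -ler_pdivrMr // mulrC -fx.
have ub : has_ubound [set complex.Re `|f x| | x in [set x : U | `|x| <= 1]].
  exists (complex.Re M) => _ [y /= y1 <-].
  have : `|f y| <= M by rewrite (le_trans (fM y)) // ler_piMr.
  by rewrite lecE => /andP[].
set y := _ *: x in xn1 fx *.
have -> : `|f y| = (complex.Re `|f y|)%:C%C by rewrite RRe_real // normr_real.
rewrite lecR; apply: ub_le_sup => //; exists y => //=; by rewrite xn1.
Qed.

End bounded_operators.

Section adjoints.
Context {R : realType} {U V : hilbertType R}.
Local Notation C := R[i].

Lemma adjoint_pair_adj (f : U -> V) (g : V -> U) :
  adjoint_pair f g -> adjoint_pair f (adj f).
Proof. by move=> fg x y; rewrite (adj_eq fg). Qed.

Lemma adjZ (f : {bounded U -> V}) a y : adj f (a *: y) = a *: adj f y.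
Proof. by apply: hdot_inj => x; rewrite ipZr -!adjP ipZr. Qed.

Lemma adj_bound (f : {bounded U -> V}) (M : C) : 0 <= M ->
  (forall x, `|f x| <= M * `|x|) -> forall y, `|adj f y| <= M * `|y|.
Proof.
move=> M0 fM y; have [->|y0] := eqVneq (adj f y) 0.
  by rewrite normr0 mulr_ge0.
have ny : 0 < `|adj f y| by rewrite normr_gt0.
rewrite -(ler_pM2l ny) -expr2 -ipxx -adjP (le_trans (real_ler_norm _)) //.
  by rewrite adjP ipxx realX // normr_real.
rewrite (le_trans (norm_dot _ _)) // mulrCA mulrA ler_wpM2r // mulrC.
Qed.

Lemma re_op_dot (f g : U -> U) x :
  adjoint_pair f g -> hdot (re_op f x) x = 'Re (hdot (f x) x).
Proof.
move=> fg; rewrite /re_op (adj_eq fg) ipZl ipDl ReE (ipC (g x)) -fg.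
by rewrite mulrC.
Qed.

End adjoints.

(** * Row contractions *)

Section rows.
Context {R : realType} {n : nat} {U : hilbertType R}.
Local Notation C := R[i].
Implicit Types X : 'I_n -> {bounded U -> U}.

Lemma row_gram_dot X x : hdot (row_gram X x) x = \sum_i `|adj (X i) x| ^+ 2.
Proof. by rewrite ip_suml; apply: eq_bigr => i _; rewrite adjP ipxx. Qed.

Lemma row_gram_bound X : exists2 M : C, 0 <= M &
  forall x, `|row_gram X x| <= M * `|x|.
Proof.
pose P i (M : C) := 0 <= M /\ forall x, `|X i x| <= M * `|x|.
have /choice[M MP] : forall i, exists M, P i M.
  by move=> i; have [M M0 XM] := bounded_opP (X i); exists M.
exists (\sum_i M i * M i) => [|x].
  by apply: sumr_ge0 => i _; have [M0 _] := MP i; rewrite mulr_ge0.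
rewrite (le_trans (ler_norm_sum _ _ _)) // mulr_suml ler_sum // => i _.
have [M0 XM] := MP i; rewrite (le_trans (XM _)) // -mulrA ler_wpM2l //.
exact: adj_bound.
Qed.

Lemma row_gramZ X a x : row_gram X (a *: x) = a *: row_gram X x.
Proof. by rewrite scaler_sumr; apply: eq_bigr => i _; rewrite adjZ linearZ. Qed.

Lemma row_norm_adj X : row_norm X <= 1 ->
  forall x, \sum_i `|adj (X i) x| ^+ 2 <= `|x| ^+ 2.
Proof.
move=> X1 x; have [M M0 XM] := row_gram_bound X.
have og : opnorm (row_gram X) <= 1.
  (* [row_norm] is a square root and [Num.sqrt] is 0 on negative reals, so this sign is treated
     apart. *)
  have [/ltW o0|o0] := ltP (opnorm (row_gram X)) 0.
    by rewrite (le_trans o0).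
  by rewrite -(sqr_sqrtr o0) expr_le1 // sqrtr_ge0.
rewrite -row_gram_dot (le_trans (real_ler_norm _)) //.
  by rewrite row_gram_dot ger0_real // sumr_ge0 // => i _; rewrite exprn_ge0.
rewrite (le_trans (norm_dot _ _)) // expr2 ler_wpM2r //.
rewrite (le_trans (opnorm_ge M0 (row_gramZ X) XM x)) // ler_piMl //.
by rewrite -[X in _ <= X]/(1%:C)%C lecR.
Qed.

(** Expand [0 <= \sum_i |k i - X_i^* y|^2] with [y = \sum_i X_i (k i)]: each cross sum equals
    [|y|^2], and the hypothesis bounds the last sum by [|y|^2]. *)
Lemma row_contraction X :
  (forall x, \sum_i `|adj (X i) x| ^+ 2 <= `|x| ^+ 2) ->
  forall k : 'I_n -> U, `|\sum_i X i (k i)| ^+ 2 <= \sum_i `|k i| ^+ 2.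
Proof.
move=> X1 k; set y := \sum_i _.
have : 0 <= \sum_i `|k i - adj (X i) y| ^+ 2.
  by apply: sumr_ge0 => i _; rewrite exprn_ge0.
have ky : \sum_i hdot (k i) (adj (X i) y) = `|y| ^+ 2.
  by rewrite -ipxx {2}/y ip_suml; apply: eq_bigr => i _; rewrite adjP.
have -> : \sum_i `|k i - adj (X i) y| ^+ 2 =
    \sum_i `|k i| ^+ 2 - `|y| ^+ 2 - `|y| ^+ 2 + \sum_i `|adj (X i) y| ^+ 2.
  have ky' : \sum_i hdot (adj (X i) y) (k i) = `|y| ^+ 2.
    rewrite -ky -[RHS]geC0_conj ?ky ?exprn_ge0 // -ky rmorph_sum.
    by apply: eq_bigr => i _; exact: ipC.
  rewrite -{1}ky -ky' -!sumrB -big_split /=; apply: eq_bigr => i _.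
  rewrite -!ipxx !ipE; ring.
rewrite -addrA => h; rewrite -subr_ge0 (le_trans h) //.
by rewrite gerDl addrC subr_le0.
Qed.

(** For [G = row_gram X], taking [k i = X_i^* x] gives
    [|G x|^2 <= r^2 <G x, x> <= r^2 |G x| |x|]. *)
Lemma row_norm_lt X (r : R) : 0 <= r -> r < 1 ->
  (forall k : 'I_n -> U,
     `|\sum_i X i (k i)| ^+ 2 <= (r ^+ 2)%:C%C * \sum_i `|k i| ^+ 2) ->
  row_norm X < 1.
Proof.
move=> r0 r1 Xr.
suff : opnorm (row_gram X) <= r ^+ 2.
  move=> h; rewrite /row_norm -sqrtr1 ltr_sqrt //.
  by rewrite (le_lt_trans h) // exprn_ilt1.
apply: opnorm_le => [|x]; first by rewrite exprn_ge0.
have [->|g0] := eqVneq (row_gram X x) 0.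
  by rewrite normr0 mulr_ge0 // ler0c exprn_ge0.
have gp : 0 < `|row_gram X x| by rewrite normr_gt0.
rewrite -(ler_pM2l gp) -expr2 (le_trans (Xr _)) // mulrCA ler_wpM2l //.
  by rewrite ler0c exprn_ge0.
rewrite -row_gram_dot (le_trans (real_ler_norm _)) ?norm_dot //.
by rewrite row_gram_dot ger0_real // sumr_ge0 // => i _; rewrite exprn_ge0.
Qed.

End rows.

(** * Words and polynomials as scalar forms *)

Section words.
Context {R : realType} {n : nat} {U : hilbertType R}.
Local Notation C := R[i].
Implicit Types (X : 'I_n -> {bounded U -> U}) (w : seq 'I_n).

Lemma adj_word X w : adjoint_pair (word_op X w) (adj (word_op X w)).
Proof.
suff [g gP] : exists g, adjoint_pair (word_op X w) g by exact: adjoint_pair_adj gP.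
elim: w => [|i w [g gP]]; first by exists idfun.
by exists (g \o adj (X i)) => x y /=; rewrite adjP gP.
Qed.

(** This is [<p(X) h, h>] expanded into scalars, with [h] a plain family, so that later arguments
    avoid the space [hpow]. *)
Definition poly_form m (p : ncpoly m) X (h : 'I_m -> U) : C :=
  \sum_(w <- finsupp p) \sum_i \sum_j p w i j * hdot (word_op X w (h j)) (h i).

Lemma re_poly_dot m (p : ncpoly m) X (h : hpow U m) :
  hdot (re_op (ncpoly_op p X) h) h = 'Re (poly_form p X h).
Proof.
(* The explicit adjoint of [p(X)]: conjugate-transposed coefficients and adjoint words. *)
rewrite (@re_op_dot _ _ _ (fun y : hpow U m => [ffun j =>
  \sum_(w <- finsupp p) \sum_i (p w i j)^* *: adj (word_op X w) (y i)])).
  congr ('Re _); rewrite hpow_hdotE /poly_form exchange_big.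
  apply: eq_bigr => i _; rewrite ffunE ip_suml; apply: eq_bigr => w _.
  by rewrite ip_suml; apply: eq_bigr => j _; rewrite ipZl.
move=> x y; rewrite !hpow_hdotE.
under eq_bigr do rewrite ffunE ip_suml.
under [RHS]eq_bigr do rewrite ffunE ip_sumr.
rewrite exchange_big [RHS]exchange_big; apply: eq_bigr => w _ /=.
under eq_bigr do rewrite ip_suml.
under [RHS]eq_bigr do rewrite ip_sumr.
rewrite exchange_big; apply: eq_bigr => j _; apply: eq_bigr => i _.
by rewrite ipZl ipZr conjCK adj_word.
Qed.

End words.

Section harnack.
Context {R : realType} {n : nat}.
Local Notation C := R[i].

Lemma re_nonneg_on_ballP (K : hilbertType R) m (p : ncpoly m) :
  re_nonneg_on_ball K p <->
  forall (X : 'I_n -> {bounded K -> K}) (h : 'I_m -> K), row_norm X < 1 ->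
    0 <= 'Re (poly_form p X h).
Proof.
split=> pP X.
  move=> h X1; have := pP X X1 [ffun i => h i].
  rewrite re_poly_dot ip0l; congr (_ <= 'Re _).
  by do 3!(apply: eq_bigr => ? _); rewrite !ffunE.
by move=> X1 h; rewrite re_poly_dot ip0l; exact: pP.
Qed.

Lemma harnack_domP (K H : hilbertType R) c (A B : 'I_n -> {bounded H -> H}) :
  harnack_dom K c A B <->
  forall m (p : ncpoly m) (h : 'I_m -> H), re_nonneg_on_ball K p ->
    'Re (poly_form p A h) <= (c ^+ 2)%:C%C * 'Re (poly_form p B h).
Proof.
split=> AB m p.
  move=> h p0; have := AB m p p0 [ffun i => h i].
  rewrite ipZl !re_poly_dot; congr ('Re _ <= _ * 'Re _).
    by do 3!(apply: eq_bigr => ? _); rewrite !ffunE.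
  by do 3!(apply: eq_bigr => ? _); rewrite !ffunE.
by move=> p0 h; rewrite ipZl !re_poly_dot; exact: AB.
Qed.

End harnack.

(** * Multi-Toeplitz kernels *)

Lemma bounded_sum (R : realType) (U V : hilbertType R) (f : {bounded U -> V})
    (I : Type) (r : seq I) (P : pred I) (F : I -> U) :
  f (\sum_(i <- r | P i) F i) = \sum_(i <- r | P i) f (F i) :> V.
Proof. exact: linear_sum. Qed.

Section toeplitz.
Context {R : realType} {n : nat} {U : hilbertType R}.
Local Notation C := R[i].
Implicit Types (X : 'I_n -> {bounded U -> U}) (w : seq 'I_n).

(* toep X a b x y = <V_a x, V_b y> when V is an isometric dilation of X. *)
Fixpoint toep X (a b : seq 'I_n) (x y : U) : C :=
  match a, b with
  | [::], _ => hdot x (word_op X b y)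
  | _, [::] => hdot (word_op X a x) y
  | i :: a', j :: b' => if i == j then toep X a' b' x y else 0
  end.

(** The analytic half of the kernel, with half weight on the diagonal so that adding the conjugate
    transpose restores [toep]. *)
Definition toep_half X (a b : seq 'I_n) (x y : U) : C :=
  if prefix b a then
    (if a == b then 2^-1 else 1) * hdot (word_op X (drop (size b) a) x) y
  else 0.

Lemma toep_halfE X a b x y :
  toep X a b x y = toep_half X a b x y + (toep_half X b a y x)^*.
Proof.
have conj2 : (2^-1 : C)^* = 2^-1 by rewrite geC0_conj // invr_ge0 ler0n.
elim: a b => [|i a IH] [|j b]; rewrite /toep_half /=.
- by rewrite rmorphM /= conj2 -ipC -mulrDl; field.
- by rewrite add0r mul1r -ipC.
- by rewrite mul1r rmorph0 addr0.
- rewrite eqseq_cons [j == i]eq_sym; have [ij|ij] /= := eqVneq i j.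
    by rewrite IH /toep_half eqseq_cons ij eqxx.
  by rewrite rmorph0 addr0.
Qed.

Definition tails (i : 'I_n) (s : seq (seq 'I_n * U)) : seq (seq 'I_n * U) :=
  [seq (behead a.1, a.2) | a <- s & ohead a.1 == Some i].

Lemma sum_tails (V : nmodType) (F : seq 'I_n -> U -> V) s :
  \sum_(a <- s) F a.1 a.2 =
  \sum_(a <- s | a.1 == [::]) F [::] a.2
  + \sum_i \sum_(a <- tails i s) F (i :: a.1) a.2.
Proof.
elim: s => [|[a x] s IH].
  by rewrite !big_nil big1 ?addr0 // => i _; rewrite /tails big_nil.
rewrite !big_cons IH /=; case: a => [|j w] /=; first by rewrite addrA.
have -> : \sum_i \sum_(a <- tails i ((j :: w, x) :: s)) F (i :: a.1) a.2 =
    \sum_i ((if i == j then F (i :: w) x else 0)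
            + \sum_(a <- tails i s) F (i :: a.1) a.2).
  apply: eq_bigr => i _; rewrite /tails /= (inj_eq Some_inj) eq_sym.
  by case: eqVneq => _; rewrite /= ?big_cons ?add0r.
by rewrite big_split -big_mkcond big_pred1_eq /= addrCA.
Qed.

(** If [V] is an isometric dilation of [X], this is the projection to [U] of the vector
    [\sum_a V_a x_a], whose squared norm is [toep_form]. *)
Definition word_sum X (s : seq (seq 'I_n * U)) : U :=
  \sum_(a <- s) word_op X a.1 a.2.

Definition toep_form X (s : seq (seq 'I_n * U)) : C :=
  \sum_(a <- s) \sum_(b <- s) toep X a.1 b.1 a.2 b.2.

(* Peeling the first letter off the words reduces the positivity of the
   Toeplitz form to the row contraction inequality. *)
Lemma toep_form_ge X s :
  (forall k : 'I_n -> U, `|\sum_i X i (k i)| ^+ 2 <= \sum_i `|k i| ^+ 2) ->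
  `|word_sum X s| ^+ 2 <= toep_form X s.
Proof.
move=> X1.
(* Induction on a strict bound [N] for the word lengths; [N = 0] leaves only the empty family. *)
suff H N : all (fun a => size a.1 < N)%N s ->
    `|word_sum X s| ^+ 2 <= toep_form X s.
  apply: (H (\max_(a <- s) size a.1).+1); apply/allP => a sa.
  by rewrite ltnS; apply: leq_bigmax_seq.
elim: N s => [|N IH] s sN.
  case: s sN => // _; rewrite /word_sum /toep_form !big_nil.
  by rewrite normr0 expr0n.
set h := \sum_(a <- s | a.1 == [::]) a.2.
set y := \sum_i X i (word_sum X (tails i s)).
have sE : word_sum X s = h + y.
  rewrite /word_sum (@sum_tails _ (fun w x => word_op X w x)); congr (_ + _).
  apply: eq_bigr => i _; rewrite linear_sum; exact: eq_bigr.
(* The kernel vanishes on words with different first letters, so among nonempty words only the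
   diagonal blocks [tails i s] contribute. *)
have QE : toep_form X s =
    hdot h (h + y) + (hdot y h + \sum_i toep_form X (tails i s)).
  rewrite /toep_form
    (@sum_tails _ (fun w x => \sum_(b <- s) toep X w b.1 x b.2)); congr (_ + _).
    rewrite /h ip_suml; apply: eq_bigr => a _.
    by rewrite -sE ip_sumr; apply: eq_bigr.
  rewrite /y ip_suml -big_split; apply: eq_bigr => i _ /=.
  rewrite /word_sum bounded_sum ip_suml -big_split; apply: eq_bigr => a _ /=.
  rewrite (@sum_tails _ (fun w x => toep X (i :: a.1) w a.2 x)) /=.
  rewrite /h ip_sumr; congr (_ + _).
  rewrite (bigD1 i) //= [X in _ + X]big1 ?addr0 => [|j ji].
    by apply: eq_bigr => b _; rewrite eqxx.
  by rewrite big1 // => b _; rewrite eq_sym (negPf ji).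
rewrite sE QE -ipxx !ipDl !ipDr -!addrA !lerD2l ipxx.
rewrite (le_trans (X1 _)) // ler_sum // => i _; apply: IH.
rewrite all_map; apply/allP => a; rewrite mem_filter => /andP[].
case: a => [[|j w] x] //= _ sa.
by have /allP/(_ _ sa) := sN.
Qed.

End toeplitz.

Section toep_poly.
Context {R : realType} {n m : nat} (ws : 'I_m -> seq 'I_n).
Local Notation C := R[i].

Definition toep_supp : {fset seq 'I_n} :=
  [fset drop (size (ws i)) (ws j) | i in 'I_m, j in 'I_m]%fset.

(** Entry [(i, j)] of the polynomial carries the one monomial [w] with [ws j = ws i ++ w], if it
    exists; [2^-1] at the empty word is the half diagonal of [toep_half]. *)
Definition toep_coef (w : seq 'I_n) : 'M[C]_m :=
  \matrix_(i, j) (if ws j == ws i ++ w then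
                    if w == [::] then 2^-1 else 1 else 0).

Definition toep_poly : ncpoly m := [fsfun w in toep_supp => toep_coef w | 0].

Lemma toep_poly_form (U : hilbertType R) (X : 'I_n -> {bounded U -> U}) h :
  poly_form toep_poly X h = \sum_i \sum_j toep_half X (ws j) (ws i) (h j) (h i).
Proof.
(* The default coefficient is 0, so the sum may run over all of [toep_supp] instead of the exact
   support. *)
have D0 : (finsupp toep_poly `<=` toep_supp)%fset by exact: finsupp_sub.
rewrite /poly_form (big_fset_incl _ D0) => [|w wD /=]; last first.
  rewrite memNfinsupp => /eqP ->.
  by do 2!(rewrite big1 // => ? _); rewrite mxE mul0r.
rewrite exchange_big; apply: eq_bigr => i _.
rewrite exchange_big; apply: eq_bigr => j _ /=.
under eq_big_seq => w wD do rewrite fsfun_fun wD.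
rewrite /toep_half; case: ifP => [/prefixP[w ij]|/negP ij].
  have -> : drop (size (ws i)) (ws j) = w by rewrite ij drop_size_cat.
  rewrite (big_fsetD1 w) /=; last first.
    by apply/imfset2P; exists i => //; exists j => //; rewrite ij drop_size_cat.
  rewrite big1_seq ?addr0 => [|v /andP[_]]; last first.
    rewrite !inE => /andP[vw _]; rewrite mxE ij eqseq_cat // eqxx /= eq_sym.
    by rewrite (negPf vw) mul0r.
  have -> : (ws j == ws i) = (w == [::]).
    by rewrite ij -[X in _ == X]cats0 eqseq_cat // eqxx.
  by rewrite mxE ij eqxx.
rewrite big1 // => w _; rewrite mxE; case: eqP => [jE|_]; last by rewrite mul0r.
by case: ij; rewrite jE prefix_prefix.
Qed.

Lemma Re_toep_poly_form (U : hilbertType R) (X : 'I_n -> {bounded U -> U}) h :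
  'Re (poly_form toep_poly X h) =
  2^-1 * toep_form X [seq (ws i, h i) | i <- index_enum 'I_m].
Proof.
rewrite ReE mulrC toep_poly_form; congr (_ * _).
rewrite /toep_form big_map rmorph_sum.
under [RHS]eq_bigr do rewrite big_map.
under [RHS]eq_bigr do under eq_bigr do rewrite toep_halfE.
rewrite [X in X + _]exchange_big -big_split; apply: eq_bigr => i _ /=.
by rewrite rmorph_sum -big_split.
Qed.

Lemma toep_poly_nonneg (K : hilbertType R) : re_nonneg_on_ball K toep_poly.
Proof.
apply/re_nonneg_on_ballP => X h /ltW X1; rewrite Re_toep_poly_form.
rewrite mulr_ge0 ?invr_ge0 // (le_trans _ (toep_form_ge _ _)) ?exprn_ge0 //.
exact/row_contraction/row_norm_adj.
Qed.

End toep_poly.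

(** * Inner products in a minimal isometric dilation *)

Section dilation.
Context {R : realType} {n : nat} {H KA : hilbertType R}.
Context (A : 'I_n -> {bounded H -> H}) (iota : {bounded H -> KA}).
Context (V : 'I_n -> {bounded KA -> KA}).
Hypothesis Vdil : minimal_isometric_dilation A iota V.
Local Notation C := R[i].

Lemma isometry_dot (U W : hilbertType R) (f : {bounded U -> W}) :
  (forall x, `|f x| = `|x|) -> forall x y, hdot (f x) (f y) = hdot x y.
Proof.
move=> fiso x y.
have nE (Z : hilbertType R) (u v : Z) :
    hdot u v + hdot v u = `|u + v| ^+ 2 - `|u| ^+ 2 - `|v| ^+ 2.
  by rewrite -!ipxx !ipE; ring.
have re u v : hdot (f u) (f v) + hdot (f v) (f u) = hdot u v + hdot v u.
  by rewrite !nE !fiso -(fiso (u + v)) raddfD.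
(* Polarisation: the identity at [x] gives the real part, the one at ['i *: x] the imaginary
   part. *)
have h1 := re x y; have := re ('i *: x) y.
rewrite linearZ !ipZl !ipZr conjCi => h2.
have i0 : 'i != 0 :> C by exact: neq0Ci.
apply: (mulfI i0).
have d : hdot (f x) (f y) - hdot (f y) (f x) = hdot x y - hdot y x :> C.
  apply: (mulfI i0); rewrite !mulrBr; move: h2; rewrite !mulNr; exact.
congr (_ * _); apply: (@mulfI _ (2 : C)); first by rewrite pnatr_eq0.
transitivity ((hdot (f x) (f y) + hdot (f y) (f x)) +
              (hdot (f x) (f y) - hdot (f y) (f x)) : C); first ring.
by rewrite h1 d; ring.
Qed.

(** Distinct [V i] have orthogonal ranges: [mid_row] at [V j y] bounds [\sum_k |V_k^* V_j y|^2] by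
    [|y|^2], and the term [k = j] alone is [|y|^2]. *)
Lemma dil_dot i j x y :
  hdot (V i x) (V j y) = if i == j then hdot x y else 0.
Proof.
have [<-|ij] := eqVneq i j; first exact/isometry_dot/(mid_isometry Vdil).
rewrite adjP (_ : adj (V i) (V j y) = 0) ?ip0r //.
have := mid_row Vdil (V j y); rewrite row_gram_dot ipxx (bigD1 j) //=.
have -> : adj (V j) (V j y) = y.
  by apply: hdot_inj => z; rewrite -adjP; exact/isometry_dot/(mid_isometry Vdil).
rewrite (mid_isometry Vdil) gerDl => s0.
have : \sum_(k < n | k != j) `|adj (V k) (V j y)| ^+ 2 == 0.
  by rewrite eq_le s0 sumr_ge0 // => k _; rewrite exprn_ge0.
rewrite psumr_eq0 => [/allP/(_ i)|k _]; last by rewrite exprn_ge0.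
by rewrite mem_index_enum ij sqrf_eq0 normr_eq0 => /(_ isT)/eqP.
Qed.

Lemma dil_row_dot (k k' : 'I_n -> KA) :
  hdot (\sum_i V i (k i)) (\sum_i V i (k' i)) = \sum_i hdot (k i) (k' i).
Proof.
rewrite ip_suml; apply: eq_bigr => i _; rewrite ip_sumr (bigD1 i) //=.
rewrite dil_dot eqxx big1 ?addr0 // => j ji.
by rewrite dil_dot eq_sym (negPf ji).
Qed.

Lemma dil_word_dot w h y : 
  hdot (word_op V w (iota h)) (iota y) = hdot (word_op A w h) y.
Proof.
elim: w y => [|i w IH] y /=.
  by apply/isometry_dot/(mid_embed Vdil).
by rewrite adjP (mid_dilation Vdil) IH adjP.
Qed.

Lemma dil_toep a b x y :
  hdot (word_op V a (iota x)) (word_op V b (iota y)) = toep A a b x y.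
Proof.
elim: a b => [|i a IH] [|j b].
- exact: dil_word_dot.
- by rewrite ipC dil_word_dot -ipC.
- exact: dil_word_dot.
- by rewrite /= dil_dot IH.
Qed.

Definition dil_sum (s : seq (seq 'I_n * H)) : KA :=
  \sum_(a <- s) word_op V a.1 (iota a.2).

Lemma dil_sum_norm s : `|dil_sum s| ^+ 2 = toep_form A s.
Proof.
rewrite -ipxx ip_suml; apply: eq_bigr => a _.
by rewrite ip_sumr; apply: eq_bigr => b _; exact: dil_toep.
Qed.

End dilation.

Lemma harnack_dom_dil (R : realType) (n : nat) (K H KA KB : hilbertType R)
    (A B : 'I_n -> {bounded H -> H})
    (iotaA : {bounded H -> KA}) (V : 'I_n -> {bounded KA -> KA})
    (iotaB : {bounded H -> KB}) (W : 'I_n -> {bounded KB -> KB}) (c : R) s :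
  minimal_isometric_dilation A iotaA V ->
  minimal_isometric_dilation B iotaB W ->
  0 <= c -> harnack_dom K c A B ->
  `|dil_sum iotaA V s| <= c%:C%C * `|dil_sum iotaB W s|.
Proof.
move=> Vdil Wdil c0 /harnack_domP AB.
(* Each entry of [s] gets its own matrix index, so [m] is [size s] and words may repeat. *)
pose ws (i : 'I_(size s)) := (tnth (in_tuple s) i).1.
have := AB _ _ (fun i => (tnth (in_tuple s) i).2) (@toep_poly_nonneg _ _ _ ws K).
rewrite !Re_toep_poly_form mulrCA ler_pM2l ?invr_gt0 //.
have -> : [seq (ws i, (tnth (in_tuple s) i).2) | i <- index_enum 'I_(size s)] = s.
  rewrite -[RHS](map_tnth_enum (in_tuple s)) enumT; apply: eq_map => i.
  exact/esym/surjective_pairing.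
rewrite -(dil_sum_norm Vdil) -(dil_sum_norm Wdil) => h.
rewrite -(@ler_pXn2r _ 2) ?nnegrE ?mulr_ge0 ?ler0c // exprMn.
by rewrite -rmorphXn.
Qed.

(** * Intertwiners *)

Section extension.
Context {R : realType} {U V : hilbertType R}.
Local Notation C := R[i].

(** [G] is a relation because a vector can have several expansions as a sum of words. The norm bound
    makes its closure single-valued, and density with completeness makes it total. *)
Lemma graph_extension (G : U -> V -> Prop) (c : C) : 0 <= c ->
  (forall a x x' y y', G x y -> G x' y' -> G (a *: x + x') (a *: y + y')) ->
  (forall x y, G x y -> `|y| <= c * `|x|) ->
  (forall (x : U) (e : C), 0 < e -> exists x' y', G x' y' /\ `|x - x'| < e) ->
  exists L : {bounded U -> V},
    (forall x y, G x y -> L x = y) /\ (forall x, `|L x| <= c * `|x|).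
Proof.
move=> c0 Glin Gc Gdense.
pose Gbar x y := forall e : C, 0 < e ->
  exists x' y', [/\ G x' y', `|x - x'| < e & `|y - y'| < e].
have Gbar_bound x y : Gbar x y -> `|y| <= c * `|x|.
  move=> xy; apply/ler_addgt0Pr => e e0.
  have c1 : 0 < c + 1 by rewrite ltr_wpDl.
  (* With this tolerance the error in [y] and [c] times the error in [x] add up to at most [e]. *)
  have [x' [y' [xy' xx' yy']]] := xy (e / (c + 1)) (divr_gt0 e0 c1).
  rewrite -[y](subrK y') (le_trans (ler_normD _ _)) //.
  apply: (@le_trans _ _ (e / (c + 1) + c * (`|x| + e / (c + 1)))).
    apply: lerD; first exact: ltW.
    rewrite (le_trans (Gc _ _ xy')) // ler_wpM2l // -[x'](subrK x) addrC.
    by rewrite (le_trans (ler_normD _ _)) // lerD2l distrC ltW.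
  rewrite mulrDr addrCA lerD2l -[X in X + _]mul1r -mulrDl addrC mulrC.
  by rewrite divfK // gt_eqF.
have Gbar_lin a x x' y y' :
    Gbar x y -> Gbar x' y' -> Gbar (a *: x + x') (a *: y + y').
  move=> xy xy' e e0; have a1 : 0 < `|a| + 1 by rewrite ltr_wpDl.
  have d0 : 0 < e / (`|a| + 1) by rewrite divr_gt0.
  have [u [v [uv xu yv]]] := xy _ d0; have [u' [v' [uv' xu' yv']]] := xy' _ d0.
  have dist (W : hilbertType R) (w w' z z' : W) :
      `|w - z| < e / (`|a| + 1) -> `|w' - z'| < e / (`|a| + 1) ->
      `|(a *: w + w') - (a *: z + z')| < e.
    move=> wz wz'; have -> : a *: w + w' - (a *: z + z') = a *: (w - z) + (w' - z').
      by rewrite scalerBr opprD addrACA.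
    rewrite (le_lt_trans (ler_normD _ _)) // normrZ.
    have -> : e = `|a| * (e / (`|a| + 1)) + e / (`|a| + 1).
      by field; rewrite gt_eqF.
    by apply: ler_ltD => //; rewrite ler_wpM2l // ltW.
  exists (a *: u + u'), (a *: v + v'); split; [exact: Glin|exact: dist|exact: dist].
have Gbar_uniq x y y' : Gbar x y -> Gbar x y' -> y = y'.
  move=> xy xy'; have := Gbar_bound _ _ (Gbar_lin (-1) _ _ _ _ xy xy').
  rewrite !scaleN1r addNr normr0 mulr0 normr_le0 addrC subr_eq0.
  by move=> /eqP ->.
have Gbar_total x : exists y, Gbar x y.
  have [e e0|d e d0 de y [x' xy xx']|e e0|z zP] :=
      @nested_limit _ V (fun e => [set y | exists2 x', G x' y & `|x - x'| < e]).
  - by have [x' [y' [xy xx']]] := Gdense x _ e0; exists y', x'.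
  - by exists x' => //; exact: lt_le_trans de.
  - have c1 : 0 < 2 * (c + 1) by rewrite mulr_gt0 // ltr_wpDl.
    exists (e / (2 * (c + 1))) => [|y y' [u uy xu] [u' uy' xu']].
      by rewrite divr_gt0.
    have := Gc _ _ (Glin (-1) _ _ _ _ uy' uy).
    rewrite !scaleN1r ![- _ + _]addrC => /le_lt_trans; apply.
    have uu : `|u - u'| <= 2 * (e / (2 * (c + 1))).
      rewrite -(subrKA x) (le_trans (ler_normD _ _)) // mulr2n mulrDl mul1r.
      by rewrite lerD // ltW // distrC.
    rewrite (le_lt_trans (ler_wpM2l c0 uu)) //.
    have -> : c * (2 * (e / (2 * (c + 1)))) = e * (c / (c + 1)).
      by field; rewrite gt_eqF // ltr_wpDl.
    by rewrite gtr_pMr // ltr_pdivrMr ?mul1r ?ltrDl // ltr_wpDl.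
  exists z => e e0; have [y [x' xy xx'] zy] := zP _ e0.
  by exists x', y.
have /choice[f fP] := Gbar_total.
have [|x|L Lf] := @bounded_op_pack _ _ _ f c c0.
- move=> a x y; apply: Gbar_uniq (fP _) _.
  exact: Gbar_lin (fP _) (fP _).
- exact: Gbar_bound (fP x).
exists L; split=> [x y xy|x]; rewrite Lf; last exact: Gbar_bound (fP x).
apply: Gbar_uniq (fP x) _ => e e0; exists x, y.
by rewrite !subrr !normr0.
Qed.

(** Lipschitz bounds in place of packaged operators make this usable for composites such as
    [L (V i x)]. *)
Lemma dense_eq (f g : U -> V) (M N : C) (D : set U) : 0 <= M -> 0 <= N ->
  (forall x x', `|f x - f x'| <= M * `|x - x'|) ->
  (forall x x', `|g x - g x'| <= N * `|x - x'|) ->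
  closure D = setT -> (forall x, D x -> f x = g x) -> f =1 g.
Proof.
move=> M0 N0 fM gN DT fg x; apply/eqP; rewrite -subr_eq0; apply/eqP.
apply: (@small_eq0 _ _ _ (M + N)) => [|e e0]; first exact: addr_ge0.
have [y [Dy]] : D `&` ball x e !=set0.
  have Dx : closure D x by rewrite DT.
  by apply: Dx; exact: nbhsx_ballx.
rewrite -ball_normE /= => xy; rewrite mulrDl.
have -> : f x - g x = (f x - f y) + (g y - g x).
  by rewrite (fg _ Dy) subrKA.
rewrite (le_trans (ler_normD _ _)) // lerD //.
  by rewrite (le_trans (fM _ _)) // ler_wpM2l // ltW.
by rewrite (le_trans (gN _ _)) // ler_wpM2l // distrC ltW.
Qed.

End extension.

Section intertwiner.
Context {R : realType} {n : nat} {H KA KB : hilbertType R}.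
Context (A : 'I_n -> {bounded H -> H}).
Context (iotaA : {bounded H -> KA}) (V : 'I_n -> {bounded KA -> KA}).
Context (iotaB : {bounded H -> KB}) (W : 'I_n -> {bounded KB -> KB}).
Hypothesis Vdil : minimal_isometric_dilation A iotaA V.
Local Notation C := R[i].

Lemma bounded_lipschitz (U1 U2 : hilbertType R) (f : {bounded U1 -> U2}) :
  exists2 M : C, 0 <= M & forall x x', `|f x - f x'| <= M * `|x - x'|.
Proof.
have [M M0 fM] := bounded_opP f; exists M => // x x'.
by rewrite -raddfB; exact: fM.
Qed.

Lemma dil_sum_cat_scale (U : hilbertType R) (iota : {bounded H -> U}) X a
    (s s' : seq (seq 'I_n * H)) :
  dil_sum iota X ([seq (b.1, a *: b.2) | b <- s] ++ s') =
  a *: dil_sum iota X s + dil_sum iota X s'.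
Proof.
rewrite /dil_sum big_cat big_map scaler_sumr; congr (_ + _).
apply: eq_bigr => b _ /=; rewrite linearZ.
by elim: b.1 => //= i w ->; rewrite linearZ.
Qed.

Lemma intertwiner_word L w h :
  dilation_intertwiner iotaA V iotaB W L ->
  L (word_op V w (iotaA h)) = word_op W w (iotaB h).
Proof. by move=> [Liota LV]; elim: w => //= i w IH; rewrite LV IH. Qed.

Lemma intertwiner_dil_sum L s :
  dilation_intertwiner iotaA V iotaB W L ->
  L (dil_sum iotaA V s) = dil_sum iotaB W s.
Proof.
move=> LP; rewrite /dil_sum bounded_sum; apply: eq_bigr => a _.
exact: intertwiner_word.
Qed.

Lemma intertwiner_uniq L L' :
  dilation_intertwiner iotaA V iotaB W L ->
  dilation_intertwiner iotaA V iotaB W L' -> L' =1 L.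
Proof.
move=> LP LP'; have [M M0 LM] := bounded_lipschitz L.
have [M' M0' LM'] := bounded_lipschitz L'.
apply: (dense_eq M0' M0 LM' LM (mid_minimal Vdil)) => _ [s ->].
by rewrite [LHS]intertwiner_dil_sum // [RHS]intertwiner_dil_sum.
Qed.

(** The inequality makes [dil_sum iotaA V s |-> dil_sum iotaB W s] well defined and bounded on a
    dense subspace; the intertwining relation holds there and extends by density. *)
Lemma intertwiner_exists (c : C) : 0 <= c ->
  (forall s, `|dil_sum iotaB W s| <= c * `|dil_sum iotaA V s|) ->
  exists L : {bounded KA -> KB},
    dilation_intertwiner iotaA V iotaB W L /\ forall x, `|L x| <= c * `|x|.
Proof.
move=> c0 cle.
have [a x x' y y' [s -> ->] [s' -> ->]|x y [s -> ->]|x e e0|L [LG Lc]] :=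
  @graph_extension _ KA KB (fun x y => exists2 s, x = dil_sum iotaA V s
      & y = dil_sum iotaB W s) c c0.
- by exists ([seq (b.1, a *: b.2) | b <- s] ++ s'); rewrite dil_sum_cat_scale.
- exact: cle.
- have Dx : closure [set x | exists s : seq (seq 'I_n * H),
      x = \sum_(a <- s) word_op V a.1 (iotaA a.2)] x by rewrite (mid_minimal Vdil).
  have [y [[s ->]]] := Dx _ (nbhsx_ballx x e e0).
  rewrite -ball_normE /= => xs.
  by exists (dil_sum iotaA V s), (dil_sum iotaB W s); split => //; exists s.
have Lsum s : L (dil_sum iotaA V s) = dil_sum iotaB W s by apply: LG; exists s.
exists L; split=> //; split=> [h|i].
  by have := Lsum [:: ([::], h)]; rewrite /dil_sum !big_seq1.
have [M M0 LM] := bounded_lipschitz L.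
have [N N0 WN] := bounded_lipschitz (W i).
have [N' N0' VN] := bounded_lipschitz (V i).
apply: (@dense_eq _ _ _ (fun x => L (V i x)) (fun x => W i (L x)) (M * N') (N * M)
  _ _ _ _ _ (mid_minimal Vdil)).
- exact: mulr_ge0.
- exact: mulr_ge0.
- by move=> x x'; rewrite (le_trans (LM _ _)) // -mulrA ler_wpM2l.
- by move=> x x'; rewrite (le_trans (WN _ _)) // -mulrA ler_wpM2l.
move=> _ [s ->]; rewrite -/(dil_sum iotaA V s) Lsum.
(* Applying the [i]-th operator prepends the letter [i] to every word, in both dilations. *)
have step (U : hilbertType R) (iota : {bounded H -> U})
    (X : 'I_n -> {bounded U -> U}) :
    X i (dil_sum iota X s) = dil_sum iota X [seq (i :: b.1, b.2) | b <- s].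
  by rewrite /dil_sum bounded_sum big_map.
by rewrite !step Lsum.
Qed.

End intertwiner.

Lemma intertwiner_cancel (R : realType) (n : nat) (H KA KB : hilbertType R)
    (A : 'I_n -> {bounded H -> H}) iotaA (V : 'I_n -> {bounded KA -> KA})
    iotaB (W : 'I_n -> {bounded KB -> KB})
    (L : {bounded KA -> KB}) (L' : {bounded KB -> KA}) :
  minimal_isometric_dilation A iotaA V ->
  dilation_intertwiner iotaA V iotaB W L ->
  dilation_intertwiner iotaB W iotaA V L' -> cancel L L'.
Proof.
move=> Vdil LP LP'; have [M M0 LM] := bounded_lipschitz L.
have [M' M0' LM'] := bounded_lipschitz L'.
apply: (@dense_eq _ _ _ (fun x => L' (L x)) id (M' * M) 1
  _ _ _ _ _ (mid_minimal Vdil)).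
- exact: mulr_ge0.
- exact: ler01.
- by move=> x x'; rewrite (le_trans (LM' _ _)) // -mulrA ler_wpM2l.
- by move=> x x'; rewrite mul1r.
move=> _ [s ->]; rewrite -/(dil_sum iotaA V s).
by rewrite (intertwiner_dil_sum _ LP) (intertwiner_dil_sum _ LP').
Qed.

(** * Gram-Schmidt compressions *)

Lemma dot_pack (R : realType) (U : lmodType R[i]) (f : U -> U -> R[i]) :
  (forall a x y z, f (a *: x + y) z = a * f x z + f y z) ->
  (forall x y, f x y = (f y x)^*) ->
  (forall x, x != 0 -> 0 < f x x) ->
  exists q : {dot U for @Num.conj R[i]}, forall x y, q x y = f x y.
Proof.
move=> flin fC fpos.
have fl z : linear_for *%R (f^~ z) by move=> a x y; exact: flin.
have fr x : linear_for (@Num.conj R[i] \; *%R) (f x).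
  move=> a y z /=.
  by rewrite fC flin rmorphD rmorphM /= -!fC.
have fh x y : f x y = (-1) ^+ false * (f y x)^* by rewrite expr0 mul1r.
pose Fb := @bilinear_isBilinear.Build R[i] _ _ _ _ _ f (conj fl fr).
pose Fh := @isHermitianSesquilinear.Build R[i] U false (@Num.conj R[i]) f fh.
pose Fd := @isDotProduct.Build R[i] U f fpos.
pose q : {dot U for @Num.conj R[i]} := HB.pack f Fb Fh Fd.
by exists q.
Qed.

Section gram_schmidt.
Context {R : realType} {U : lmodType R[i]} (q : {dot U for @Num.conj R[i]}).
Context {K : hilbertType R}.
Local Notation C := R[i].
Implicit Types (es : seq (U * K)) (x y : U) (k : K).

(** [es] lists pairs [(e, f)]. For a matched list, [gs_to] and [gs_from] are mutually adjoint
    partial isometries between [(U, q)] and [K], and [gs_to] followed by [gs_from] is the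
    [q]-orthogonal projection onto the span of the [e]. *)
Definition gs_to es y : K := \sum_(a <- es) q y a.1 *: a.2.
Definition gs_from es k : U := \sum_(a <- es) hdot k a.2 *: a.1.

(* For duplicate-free es this says that the a.1 are q-orthonormal and the a.2
   are orthonormal. *)
Definition matched es :=
  forall a, a \in es -> gs_to es a.1 = a.2 /\ gs_from es a.2 = a.1.

Lemma gs_to_linear es a x y : gs_to es (a *: x + y) = a *: gs_to es x + gs_to es y.
Proof.
rewrite /gs_to scaler_sumr -big_split; apply: eq_bigr => b _ /=.
by rewrite linearDl linearZl_LR scalerDl scalerA.
Qed.

Lemma gs_from_linear es a k k' :
  gs_from es (a *: k + k') = a *: gs_from es k + gs_from es k'.
Proof.
rewrite /gs_from scaler_sumr -big_split; apply: eq_bigr => b _ /=.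
by rewrite ipDl ipZl scalerDl scalerA.
Qed.

HB.instance Definition _ es :=
  GRing.isLinear.Build C U K *:%R (gs_to es) (gs_to_linear es).
HB.instance Definition _ es :=
  GRing.isLinear.Build C K U *:%R (gs_from es) (gs_from_linear es).

Lemma gs_adj es k y : q (gs_from es k) y = hdot k (gs_to es y).
Proof.
rewrite /gs_from /gs_to linear_sumlz ip_sumr; apply: eq_bigr => a _.
by rewrite linearZl_LR ipZr -dotC mulrC.
Qed.

Section matched_maps.
Context es (esP : matched es).

Lemma gs_toK k : gs_from es (gs_to es (gs_from es k)) = gs_from es k.
Proof.
rewrite {2 3}/gs_from [gs_to es (\sum_(_ <- _) _)]linear_sum linear_sum /=.
apply: eq_big_seq => a /esP[a1 a2].
by rewrite !linearZ /= a1 a2.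
Qed.

Lemma gs_fromK y : gs_to es (gs_from es (gs_to es y)) = gs_to es y.
Proof.
rewrite {2 3}/gs_to [gs_from es (\sum_(_ <- _) _)]linear_sum linear_sum /=.
apply: eq_big_seq => a /esP[a1 a2].
by rewrite !linearZ /= a2 a1.
Qed.

(** [gs_from] followed by [gs_to] is an orthogonal projection [P] of [K], and the left side is
    [|P k|^2]; expand [|k - P k|^2 >= 0]. *)
Lemma gs_from_le k : q (gs_from es k) (gs_from es k) <= `|k| ^+ 2.
Proof.
set s := q _ _.
have s0 : s^* = s by rewrite geC0_conj // dnorm_ge0.
have ks : hdot k (gs_to es (gs_from es k)) = s by rewrite -gs_adj.
have sk : hdot (gs_to es (gs_from es k)) k = s by rewrite ipC ks.
have ss : hdot (gs_to es (gs_from es k)) (gs_to es (gs_from es k)) = s.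
  by rewrite -gs_adj gs_toK.
have : 0 <= `|k - gs_to es (gs_from es k)| ^+ 2 by rewrite exprn_ge0.
rewrite -ipxx !ipE ks sk ss -[s <= _]subr_ge0 ipxx; congr (_ <= _); ring.
Qed.

Lemma gs_to_le y : `|gs_to es y| ^+ 2 <= q y y.
Proof.
rewrite -ipxx; set s := hdot _ _.
have s0 : s^* = s by rewrite /s -ipC.
have sy : q (gs_from es (gs_to es y)) y = s by rewrite gs_adj.
have ys : q y (gs_from es (gs_to es y)) = s by rewrite dotC sy.
have ss : q (gs_from es (gs_to es y)) (gs_from es (gs_to es y)) = s.
  by rewrite gs_adj gs_fromK.
have := dnorm_ge0 q (y - gs_from es (gs_to es y)).
rewrite linearBl !linearBr /= sy ys ss -[s <= _]subr_ge0; congr (_ <= _); ring.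
Qed.

End matched_maps.

Hypothesis K_infinite : infinite_dimensional K.

(** Infinite dimension of [K] enters here: were every [k] fixed by the projection of [K], finitely
    many vectors would span [K]. The normalised residual of a vector that is not fixed is the new
    direction. *)
Lemma gs_fresh es : matched es ->
  exists f : K, `|f| = 1 /\ gs_from es f = 0.
Proof.
move=> esP.
have [[k0 k0P]|/forallNP kP] :=
    pselect (exists k, k != gs_to es (gs_from es k)); last first.
  case: K_infinite; exists (size es), (fun i => (tnth (in_tuple es) i).2) => k.
  exists (fun i => q (gs_from es k) (tnth (in_tuple es) i).1).
  have /negP/negPn/eqP -> := kP k; rewrite {1}/gs_to big_tnth.
  by rewrite gs_toK.
set k := k0 - gs_to es (gs_from es k0).
have kn0 : `|k| != 0 by rewrite normr_eq0 subr_eq0.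
exists (`|k|^-1 *: k); split; first by rewrite normrZ normfV normr_id mulVf.
by rewrite linearZ /= /k linearB /= gs_toK // subrr scaler0.
Qed.

(** One Gram-Schmidt step: the normalised residual [e] of [u] is paired with a fresh unit vector [f]
    of [K]. *)
Lemma gs_extend es u : matched es -> exists es',
  [/\ matched es',
      forall x, gs_from es (gs_to es x) = x -> gs_from es' (gs_to es' x) = x
    & gs_from es' (gs_to es' u) = u].
Proof.
move=> esP; set u' := u - gs_from es (gs_to es u).
have [u0|u0] := eqVneq u' 0.
  by exists es; split=> //; apply/esym/eqP; rewrite -subr_eq0 -/u' u0.
have [f [f1 Sf]] := gs_fresh esP.
have qu : 0 < q u' u' by rewrite dnorm_gt0.
set s := sqrtC (q u' u').
have s0 : s != 0 by rewrite sqrtC_eq0 gt_eqF.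
have sr : s^* = s by rewrite geC0_conj // sqrtC_ge0 ltW.
have ss : s * s = q u' u' by rewrite -expr2 sqrtCK.
set e := s^-1 *: u'.
have Tu' : gs_to es u' = 0 by rewrite linearB /= gs_fromK // subrr.
have Te : gs_to es e = 0 by rewrite linearZ /= Tu' scaler0.
have qee : q e e = 1.
  by rewrite linearZl_LR linearZr_LR /= fmorphV /= sr -ss; field.
have ff : hdot f f = 1 by rewrite ipxx f1 expr1n.
have fT x : hdot (gs_to es x) f = 0.
  by rewrite ipC -gs_adj Sf linear0l rmorph0.
have qSe k : q (gs_from es k) e = 0 by rewrite gs_adj Te ip0r.
have TE x : gs_to ((e, f) :: es) x = q x e *: f + gs_to es x.
  by rewrite /gs_to big_cons.
have SE k : gs_from ((e, f) :: es) k = hdot k f *: e + gs_from es k.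
  by rewrite /gs_from big_cons.
have ST x : gs_from ((e, f) :: es) (gs_to ((e, f) :: es) x) =
    q x e *: e + gs_from es (gs_to es x).
  by rewrite SE TE ipDl ipZl ff mulr1 fT addr0 linearP /= Sf scaler0 add0r.
exists ((e, f) :: es); split=> [a|x xP|].
- rewrite inE => /predU1P[->|aes].
    by rewrite TE SE qee ff Te Sf !scale1r !addr0.
  have [a1 a2] := esP _ aes.
  have qa : q a.1 e = 0 by rewrite -a2 qSe.
  have fa : hdot a.2 f = 0 by rewrite -a1 fT.
  by rewrite TE SE a1 a2 qa fa !scale0r !add0r.
(* A vector fixed by the old projection is [q]-orthogonal to [e], so the new projection still fixes
   it. *)
- have qx : q x e = 0 by rewrite -xP qSe.
  by rewrite ST xP qx scale0r add0r.
- have que : q u e = s.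
    rewrite -[X in q X e](subrK (gs_from es (gs_to es u))) -/u' linearDl /= qSe.
    by rewrite addr0 linearZr_LR /= fmorphV /= sr -ss mulKf.
  by rewrite ST que scalerA divff // scale1r subrK.
Qed.

Lemma gram_schmidt (s : seq U) : exists es, matched es /\
  forall x, x \in s -> gs_from es (gs_to es x) = x.
Proof.
elim: s => [|u s [es [esP sP]]]; first by exists [::].
have [es' [es'P sub uP]] := gs_extend u esP.
exists es'; split=> // x; rewrite inE => /predU1P[->//|/sP]; exact: sub.
Qed.

End gram_schmidt.

(** * Transfer of positivity from the ball *)

(** The real part is a real polynomial in [r], hence continuous at 1; this removes the factor that
    makes the compressions strict. *)
Lemma Re_sum_limit (R : realType) (I : Type) (l : seq I) (d : I -> nat)
    (c : I -> R[i]) :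
  (forall r : R, 0 <= r < 1 ->
     0 <= 'Re (\sum_(w <- l) (r%:C%C) ^+ d w * c w)) ->
  0 <= 'Re (\sum_(w <- l) c w).
Proof.
move=> cr; pose P : {poly R} := \sum_(w <- l) complex.Re (c w) *: 'X^(d w).
have PE (r : R) : (P.[r])%:C%C = 'Re (\sum_(w <- l) (r%:C%C) ^+ d w * c w).
  rewrite -complexRe /P horner_sum !raddf_sum /=.
  apply: eq_bigr => w _; congr (_%:C%C); rewrite hornerZ hornerXn -rmorphXn /=.
  by case: (c w) => a b /=; rewrite mul0r subr0 mulrC.
suff : 0 <= P.[1].
  rewrite -ler0c PE; congr (_ <= 'Re _); apply: eq_bigr => w _.
  by rewrite expr1n mul1r.
have P1 : P.[r] @[r --> (1 : R)^'-] --> P.[1].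
  by apply: cvg_at_left_filter; exact: continuous_horner.
apply: (cvgr_to_ge P1); near=> r.
rewrite -ler0c PE; apply: cr; apply/andP; split; near: r.
  exact: nbhs_left_ge.
exact: nbhs_left_lt.
Unshelve. all: by end_near. Qed.

Section transfer.
Context {R : realType} {n : nat} {K U : hilbertType R}.
Hypothesis K_infinite : infinite_dimensional K.
Context (q : {dot U for @Num.conj R[i]}) (W : 'I_n -> {bounded U -> U}).
Local Notation C := R[i].
Hypothesis Wrow : forall k : 'I_n -> U,
  q (\sum_i W i (k i)) (\sum_i W i (k i)) <= \sum_i q (k i) (k i).

Definition compress (es : seq (U * K)) (r : R) i (k : K) : K :=
  r%:C%C *: gs_to q es (W i (gs_from es k)).

Lemma compress_row es r (k : 'I_n -> K) : matched q es -> 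
  `|\sum_i compress es r i (k i)| ^+ 2 <= (r ^+ 2)%:C%C * \sum_i `|k i| ^+ 2.
Proof.
move=> esP; rewrite /compress -scaler_sumr normrZ exprMn.
have -> : `|r%:C%C| ^+ 2 = (r ^+ 2)%:C%C :> C.
  by rewrite -normrX -rmorphXn ger0_norm // ler0c sqr_ge0.
rewrite ler_wpM2l ?ler0c ?sqr_ge0 //.
have -> : \sum_i gs_to q es (W i (gs_from es (k i))) =
    gs_to q es (\sum_i W i (gs_from es (k i))) by rewrite linear_sum.
rewrite (le_trans (gs_to_le esP _)) // (le_trans (Wrow _)) //.
by apply: ler_sum => i _; exact: (gs_from_le esP).
Qed.

Lemma compress_op es r : matched q es -> 0 <= r < 1 ->
  exists X : 'I_n -> {bounded K -> K},
    (forall i, X i =1 compress es r i) /\ row_norm X < 1.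
Proof.
move=> esP /andP[r0 r1].
have /choice[X XE] : forall i, exists L : {bounded K -> K}, L =1 compress es r i.
  move=> i; apply: (@bounded_op_pack _ _ _ _ r%:C%C); first by rewrite ler0c.
    move=> a x y; rewrite /compress gs_from_linear linearP gs_to_linear.
    by rewrite scalerDr !scalerA mulrC.
  move=> x; rewrite -(@ler_pXn2r _ 2) ?nnegrE ?mulr_ge0 ?ler0c // exprMn.
  (* A row with a single nonzero entry turns the row bound into a bound on one operator. *)
  have := compress_row r (fun j => if j == i then x else 0) esP.
  rewrite (bigD1 i) //= eqxx [X in _ + X]big1 ?addr0 => [|j /negPf ->]; last first.
    by rewrite /compress !linear0.
  have -> : \sum_j `|if j == i then x else 0| ^+ 2 = `|x| ^+ 2.
    rewrite (bigD1 i) //= eqxx big1 ?addr0 // => j /negPf ->.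
    by rewrite normr0 expr0n.
  by rewrite rmorphXn.
exists X; split=> //; apply: (row_norm_lt r0 r1) => k.
under eq_bigr do rewrite XE.
exact: compress_row.
Qed.

(** The compression after each letter loses nothing, since every suffix of [w] applied to [x] is
    fixed by the projection; only one factor [r] per letter remains. *)
Lemma compress_word es r (X : 'I_n -> {bounded K -> K}) w x :
  (forall i, X i =1 compress es r i) ->
  (forall k, gs_from es (gs_to q es (word_op W (drop k w) x)) =
             word_op W (drop k w) x) ->
  word_op X w (gs_to q es x) = r%:C%C ^+ size w *: gs_to q es (word_op W w x).
Proof.
move=> XE; elim: w => [|i w IH] wP /=; first by rewrite scale1r.
rewrite IH => [|k]; last exact: (wP k.+1).
rewrite XE /compress !linearZ /= linearZ /= scalerA.
by have := wP 1%N; rewrite /= drop0 => ->; rewrite exprS.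
Qed.

Lemma transfer_nonneg m (p : ncpoly m) (x : 'I_m -> U) :
  re_nonneg_on_ball K p ->
  0 <= 'Re (\sum_(w <- finsupp p) \sum_i \sum_j
              p w i j * q (word_op W w (x j)) (x i)).
Proof.
move=> /re_nonneg_on_ballP p0.
(* All suffixes of the words of [p] applied to all [x j]. The range up to [(size w).+1] includes the
   empty suffix, and the added empty word secures the [x j] themselves. *)
pose s : seq U := flatten [seq [seq word_op W (drop k w) (x j) |
    k <- iota 0 (size w).+1, j <- enum 'I_m] | w <- [::] :: finsupp p].
have [es [esP sP]] := gram_schmidt q K_infinite s.
apply: (@Re_sum_limit _ _ _ size) => r r1.
have [X [XE X1]] := compress_op esP r1.
have := p0 X (fun j => gs_to q es (x j)) X1.
congr (_ <= 'Re _); apply: eq_big_seq => w wp.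
rewrite mulr_sumr; apply: eq_bigr => i _; rewrite mulr_sumr; apply: eq_bigr => j _.
have xs v k l : v \in [::] :: enum_fset (finsupp p) ->
    gs_from es (gs_to q es (word_op W (drop k v) (x l))) =
    word_op W (drop k v) (x l).
  move=> vp; apply: sP; apply/flatten_mapP; exists v => //.
  (* Dropping past the end gives the empty word, so an arbitrary [k] reduces to one listed in
     [s]. *)
  have -> : drop k v = drop (minn k (size v)) v.
    by rewrite /minn; case: ltnP => // kv; rewrite drop_oversize // drop_size.
  apply/allpairsP; exists (minn k (size v), l); split=> //.
    by rewrite mem_iota ltnS; exact: geq_minr.
  by rewrite mem_enum.
rewrite (compress_word XE) => [|k]; last by apply: xs; rewrite inE wp orbT.
rewrite ipZl mulrCA; congr (_ * (_ * _)).
rewrite ipC -gs_adj.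
by have /= -> := xs [::] 0%N i (mem_head _ _); rewrite -dotC.
Qed.

End transfer.

(** * Harnack domination and norms of intertwiners *)

Section domination.
Context {R : realType} {n : nat} {K H KA KB : hilbertType R}.
Hypothesis K_infinite : infinite_dimensional K.
Context (A B : 'I_n -> {bounded H -> H}).
Context (iotaA : {bounded H -> KA}) (V : 'I_n -> {bounded KA -> KA}).
Context (iotaB : {bounded H -> KB}) (W : 'I_n -> {bounded KB -> KB}).
Hypothesis Vdil : minimal_isometric_dilation A iotaA V.
Hypothesis Wdil : minimal_isometric_dilation B iotaB W.
Local Notation C := R[i].

(* The strict inequality c < c' makes c'^2 - L^*L positive definite. *)
Lemma intertwiner_harnack_dom (L : {bounded KB -> KA}) (c c' : R) :
  dilation_intertwiner iotaB W iotaA V L ->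
  0 <= c -> c < c' -> (forall x, `|L x| <= c%:C%C * `|x|) ->
  harnack_dom K c' A B.
Proof.
move=> LP c0 cc' Lc; set g : C := (c' ^+ 2)%:C%C.
have gr : g^* = g by exact: conjc_real.
have [a x y z|x y|x x0|q qE] :=
  @dot_pack R KB (fun x y => g * hdot x y - hdot (L x) (L y)).
- by rewrite linearP !ipDl !ipZl; ring.
- by rewrite rmorphB rmorphM /= gr -!ipC.
- rewrite subr_gt0 !ipxx (@le_lt_trans _ _ ((c%:C%C * `|x|) ^+ 2)) //.
    by rewrite ler_pXn2r ?nnegrE ?mulr_ge0 ?ler0c.
  rewrite exprMn ltr_pM2r ?exprn_gt0 ?normr_gt0 // /g rmorphXn /=.
  by rewrite ltr_pXn2r ?nnegrE ?ler0c ?ltcR // (le_trans c0) // ltW.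
apply/harnack_domP => m p h p0.
have Wrow (k : 'I_n -> KB) :
    q (\sum_i W i (k i)) (\sum_i W i (k i)) <= \sum_i q (k i) (k i).
  have LE : L (\sum_i W i (k i)) = \sum_i V i (L (k i)).
    by rewrite bounded_sum; apply: eq_bigr => i _; rewrite LP.2.
  rewrite qE LE (dil_row_dot Wdil) mulr_sumr.
  (* [V] and [W] are both row isometries, so the inequality holds with equality. *)
  rewrite (dil_row_dot Vdil) -sumrB le_eqVlt; apply/orP; left; apply/eqP.
  by apply: eq_bigr => i _; rewrite qE.
have pos := transfer_nonneg K_infinite Wrow (fun j => iotaB (h j)) p0.
have greal : g \is Num.real by rewrite CrealE gr.
rewrite -subr_ge0 -(ReMl greal) -raddfB /=; move: pos.
congr (_ <= 'Re _); rewrite /poly_form mulr_sumr -sumrB; apply: eq_bigr => w _.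
rewrite mulr_sumr -sumrB; apply: eq_bigr => i _.
rewrite mulr_sumr -sumrB; apply: eq_bigr => j _.
rewrite qE (intertwiner_word _ _ LP) LP.1.
by rewrite (dil_word_dot Vdil) (dil_word_dot Wdil); ring.
Qed.

(** Domination produces some intertwiner bounded by [c], and uniqueness identifies it with [L]. *)
Lemma intertwiner_harnack_norm (L : {bounded KB -> KA}) (c : R) :
  dilation_intertwiner iotaB W iotaA V L -> 0 <= c ->
  harnack_dom K c A B -> forall x, `|L x| <= c%:C%C * `|x|.
Proof.
move=> LP c0 AB.
have cC : 0 <= c%:C%C :> C by rewrite ler0c.
have [L' [L'P L'c]] := intertwiner_exists Wdil cC
  (fun s => harnack_dom_dil s Vdil Wdil c0 AB).
by move=> x; rewrite -(intertwiner_uniq Wdil LP L'P).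
Qed.

End domination.

(** * Operator norms, the case of zero [H], and the infimum *)

Lemma opnorm_ge0 (R : realType) (U V : hilbertType R) (f : U -> V) : 0 <= opnorm f.
Proof.
rewrite /opnorm; set S := [set _ | _ in _].
have [hS|/sup_out -> //] := pselect (has_sup S).
apply: (@le_trans _ _ (complex.Re `|f 0|)).
  by have := normr_ge0 (f 0); rewrite lecE => /andP[].
by apply: ub_le_sup; [case: hS|exists 0 => //=; rewrite normr0].
Qed.

Lemma opnorm_bound (R : realType) (U V : hilbertType R) (f : {bounded U -> V}) x :
  `|f x| <= (opnorm f)%:C%C * `|x|.
Proof.
have [M M0 fM] := bounded_opP f.
by apply: (opnorm_ge M0) => // a y; rewrite linearZ.
Qed.

(** When [H] is zero every dilation sum vanishes, so an intertwiner with bound 0 exists, and it is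
    [L] by uniqueness. *)
Lemma intertwiner_opnorm0 (R : realType) (n : nat) (H KA KB : hilbertType R)
    (A : 'I_n -> {bounded H -> H}) iotaA (V : 'I_n -> {bounded KA -> KA})
    iotaB (W : 'I_n -> {bounded KB -> KB}) (L : {bounded KA -> KB}) :
  minimal_isometric_dilation A iotaA V ->
  dilation_intertwiner iotaA V iotaB W L -> (forall h : H, h = 0) ->
  opnorm L <= 0.
Proof.
move=> Vdil LP H0.
have [|L' [L'P L'0]] := @intertwiner_exists _ _ _ _ _ _ _ _ iotaB W Vdil 0 (lexx 0).
  move=> s; rewrite mul0r /dil_sum big1 ?normr0 // => -[w h] _ /=.
  by rewrite (H0 h) linear0; elim: w => //= i w ->; rewrite linear0.
apply: opnorm_le => // x.
by rewrite -(intertwiner_uniq Vdil LP L'P) L'0.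
Qed.

(** Membership of [b] in [S] is left open, which absorbs the passage from [c] to a larger [c'] in
    [intertwiner_harnack_dom]. *)
Lemma inf_between (R : realType) (S : set R) (b : R) :
  (forall c, S c -> b <= c) -> (forall c, b < c -> S c) -> inf S = b.
Proof.
move=> Sb bS; apply/eqP; rewrite eq_le; apply/andP; split; last first.
  by apply: lb_le_inf => //; exists (b + 1); apply: bS; rewrite ltrDl.
apply/ler_addgt0Pr => e e0; apply: ge_inf; first by exists b.
by apply: bS; rewrite ltrDl.
Qed.

Theorem theorem4p2 (R : realType) (n : nat) (n_gt0 : (0 < n)%N)
    (K : hilbertType R) (K_infinite : infinite_dimensional K)
    (H : hilbertType R) (A B : 'I_n -> {bounded H -> H})
    (A_ball : row_norm A <= 1) (B_ball : row_norm B <= 1)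
    (AB : harnack_equiv K A B)
    (KA : hilbertType R) (iotaA : {bounded H -> KA})
    (V : 'I_n -> {bounded KA -> KA})
    (V_dil : minimal_isometric_dilation A iotaA V)
    (KB : hilbertType R) (iotaB : {bounded H -> KB})
    (W : 'I_n -> {bounded KB -> KB})
    (W_dil : minimal_isometric_dilation B iotaB W) :
  exists (L : {bounded KA -> KB}) (Linv : {bounded KB -> KA}),
    [/\ dilation_intertwiner iotaA V iotaB W L,
        forall L' : {bounded KA -> KB},
          dilation_intertwiner iotaA V iotaB W L' -> L' =1 L,
        cancel L Linv,
        cancel Linv L
      & hyperbolic_metric K A B = ln (Num.max (opnorm L) (opnorm Linv))].

Proof.
have [c0 [c01 [ABc BAc]]] := AB.
have c0_ge0 : 0 <= c0 by rewrite (le_trans ler01).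
have cC : 0 <= c0%:C%C :> R[i] by rewrite ler0c.
(* The directions cross: [L] from [KA] to [KB] is bounded because [B] is dominated by [A]. *)
have [L [LP Lc]] := intertwiner_exists V_dil cC
  (fun s => harnack_dom_dil s W_dil V_dil c0_ge0 BAc).
have [Linv [LinvP Linvc]] := intertwiner_exists W_dil cC
  (fun s => harnack_dom_dil s V_dil W_dil c0_ge0 ABc).
exists L, Linv; split=> [//|L' L'P|||].
- exact: (intertwiner_uniq V_dil LP L'P).
- exact: (intertwiner_cancel V_dil LP LinvP).
- exact: (intertwiner_cancel W_dil LinvP LP).
set b := Num.max _ _.
(* The constants satisfy [1 <= c], so the infimum is [Num.max 1 b]; the two cases below remove the
   1. *)
have infE (a : R) : 1 <= a -> Num.max 1 b = a -> 
    inf [set c : R | 1 <= c /\ harnack_equiv_by K c A B] = a.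
  move=> a1 <-; apply: inf_between => [c [c1 [dAB dBA]]|c].
    have cge0 : 0 <= c by rewrite (le_trans ler01).
    rewrite ge_max c1 /= ge_max; apply/andP; split; apply: opnorm_le => //.
      exact: (intertwiner_harnack_norm W_dil V_dil LP cge0 dBA).
    exact: (intertwiner_harnack_norm V_dil W_dil LinvP cge0 dAB).
  rewrite gt_max => /andP[c1]; rewrite gt_max => /andP[cL cLinv].
  split; first exact: ltW.
  split.
    exact: (intertwiner_harnack_dom K_infinite V_dil W_dil LinvP (opnorm_ge0 _) cLinv
      (opnorm_bound Linv)).
  exact: (intertwiner_harnack_dom K_infinite W_dil V_dil LP (opnorm_ge0 _) cL
    (opnorm_bound L)).
rewrite /hyperbolic_metric (infE (Num.max 1 b)) ?le_max ?lexx //.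
have [[h h0]|/forallNP H0] := pselect (exists h : H, h != 0).
  (* [L] sends [iotaA h] to [iotaB h], a nonzero vector of the same norm. *)
  have L1 : 1 <= opnorm L.
    have := opnorm_bound L (iotaA h).
    rewrite LP.1 (mid_embed V_dil) (mid_embed W_dil).
    by rewrite -[X in X <= _]mul1r ler_pM2r ?normr_gt0 // -[1]/(1%:C)%C lecR.
  by congr ln; apply/max_idPr; rewrite /b le_max L1.
have {}H0 h : h = 0 :> H by apply/eqP/negPn/negP; exact: H0.
(* For zero [H] the infimum is 1, while [b <= 0]; as [ln] is 0 on nonpositive reals, both sides are
   0. *)
have b0 : b <= 0.
  rewrite ge_max (intertwiner_opnorm0 V_dil LP H0).
  exact: (intertwiner_opnorm0 W_dil LinvP H0).
by rewrite (max_idPl _) ?(le_trans b0) // ln1 ln0.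
Qed.
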